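(* Let $\mathcal{X}$ be an infinite-dimensional complex Banach space and let $\{0\}\neq \mathcal{A}\subseteq \mathcal{B}(\mathcal{X})$ be a norm closed algebra. If every operator in $\mathcal{A}$ is quasinilpotent and polynomially compact, then $\mathcal{A}$ has a non-trivial hyperinvariant subspace.
   Context: $\mathcal{B}(\mathcal{X})$ is the algebra of all bounded linear operators on $\mathcal{X}$. Algebras of operators are subalgebras of $\mathcal{B}(\mathcal{X})$, not assumed to contain the identity. An operator $T$ is quasinilpotent if its spectral radius is $0$. An operator $T$ is polynomially compact if there is a non-zero complex polynomial $p$ such that $p(T)$ is compact. The commutant of a non-empty set $\mathcal{S}\subseteq\mathcal{B}(\mathcal{X})$ is $\mathcal{S}'=\{T\in\mathcal{B}(\mathcal{X}) : TS=ST \text{ for all } S\in\mathcal{S}\}$. A subspace means a closed linear subspace of $\mathcal{X}$; it is non-trivial if it is neither $\{0\}$ nor $\mathcal{X}$. A subspace $\mathcal{M}$ is hyperinvariant for $\mathcal{S}$ if $T\mathcal{M}\subseteq\mathcal{M}$ for every $T\in\mathcal{S}\cup\mathcal{S}'$. *)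

(* Defs.v *)
From HB Require Import structures.
From mathcomp Require Import all_boot all_order all_algebra.
From mathcomp Require Import complex.
From mathcomp Require Import all_classical all_reals all_analysis.

Set Implicit Arguments.
Unset Strict Implicit.
Unset Printing Implicit Defensive.

Import Order.TTheory GRing.Theory Num.Theory.
Import numFieldNormedType.Exports.

Local Open Scope classical_set_scope.
Local Open Scope ring_scope.

(* Norms over a normed space with scalars [R[i]] take values in [R[i]]
   (they are real and nonnegative there); [rnorm] is the same number in [R]. *)
Definition rnorm (R : realType) (V : normedZmodType R[i]) (v : V) : R :=
  complex.Re `|v|.

Section Operators.
Variables (R : realType) (X : normedModType R[i]).
Implicit Types (S T : X -> X) (A : set (X -> X)) (M : set X).

Definition infinite_dimensional : Prop :=
  ~ exists (n : nat) (e : 'I_n -> X),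
      forall x : X, exists c : 'I_n -> R[i], x = \sum_(i < n) c i *: e i.

(* The carrier of B(X), as a set of plain functions; addition, scaling,
   composition and the zero operator are then [\+], [\*:], [\o] and [cst 0]. *)
Definition bounded_operator : set (X -> X) :=
  [set T | linear T /\ exists c : R[i], forall x : X, `|T x| <= c * `|x|].

Definition opnorm T : R :=
  sup [set rnorm (T x) | x in [set x : X | `|x| <= 1]].

(* Non-unital: the identity operator is not required to belong to [A]. *)
Definition operator_algebra A : Prop :=
  [/\ A `<=` bounded_operator,
      A (cst 0),
      forall S T, A S -> A T -> A (S \+ T),
      forall (a : R[i]) T, A T -> A (a \*: T) &
      forall S T, A S -> A T -> A (S \o T)].

Definition norm_closed A : Prop :=
  forall T, bounded_operator T ->
    (forall e : R, 0 < e -> exists2 S, A S & opnorm (T \- S) < e) -> A T.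

Definition spectrum T : set R[i] :=
  [set l | ~ exists S, [/\ bounded_operator S,
                           S \o (T \- l \*: idfun) = idfun &
                           (T \- l \*: idfun) \o S = idfun]].

Definition spectral_radius T : \bar R :=
  ereal_sup [set (rnorm l)%:E | l in spectrum T].

Definition quasinilpotent T : Prop := spectral_radius T = 0%E.

Definition compact_operator T : Prop :=
  bounded_operator T /\ precompact (T @` [set x : X | `|x| <= 1]).

Definition op_horner (p : {poly R[i]}) T : X -> X :=
  fun x => \sum_(i < size p) p`_i *: iter i T x.

Definition polynomially_compact T : Prop :=
  exists2 p : {poly R[i]}, p != 0 & compact_operator (op_horner p T).

Definition commutant A : set (X -> X) :=
  [set T | bounded_operator T /\ forall S, A S -> T \o S = S \o T].

Definition closed_subspace M : Prop :=
  [/\ closed M, M 0 &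
      forall (a : R[i]) (x y : X), M x -> M y -> M (a *: x + y)].

Definition nontrivial_subspace M : Prop :=
  [/\ closed_subspace M, M <> [set 0] & M <> setT].

Definition hyperinvariant A M : Prop :=
  forall T, (A `|` commutant A) T -> T @` M `<=` M.

End Operators.

Arguments infinite_dimensional {R} X.

(* Main.v *)
Require Import Defs.
From mathcomp Require Import all_boot all_order all_algebra.
From mathcomp Require Import finmap complex.
From mathcomp Require Import all_classical all_reals all_analysis.
From mathcomp Require Import ring lra zify.

(** Quasinilpotence enters through the fact that no operator of [A] has a non-zero
    fixed vector ([quasinilpotent_fixpoint]).  A polynomial relation
    without constant term between the iterates of [T] at [x] can then be simplified
    to [T^q x = 0], because its factor with non-zero constant term is injective
    ([relation_iter_eq0]).

    If no non-zero operator of [A] is compact, [T p(T)] vanishes as soon as [p(T)] is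
    compact, so every operator of [A] is nilpotent.  By Baire's argument the index of
    nilpotency is bounded on some ball of the closed algebra [A], and Levitzki's
    sandwich trick on that ball gives [D <> 0] in [A] with [D A D = 0]
    ([nil_ball_sandwich]).  Such a [D] yields a non-trivial hyperinvariant
    subspace, defined as a kernel ([sandwich_hyperinvariant]).

    A non-zero finite-rank operator [T] in [A] is no harder: the operators [T B] with
    [B] in [A] are nilpotent of index bounded by the rank of [T], and the same trick
    applies ([finite_rank_hyperinvariant]).

    Suppose finally that [A] contains a compact [K <> 0] and has no non-trivial
    hyperinvariant subspace.  The algebra generated by [A] and its commutant acts transitively, and
    Hilden's version of Lomonosov's argument produces finitely many compact operators
    of [A] whose products of length [n] do not decay with [n], after scaling
    ([transitive_growth]).  This is impossible unless [A] contains a non-zero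
    finite-rank operator ([growth_finite_rank]), which is a case already settled.
    Indeed, suitable products, divided by their norms, have a non-zero limit in
    operator norm because their outer factors are compact.  A product of [n] letters
    maps the unit ball into [k^n] balls of radius [4^-n], for a fixed [k]; if the
    limit had rank at least [q] with [2^q > k], these products would expand a
    [q]-dimensional grid too much for that.  Counting replaces here the usual appeal
    to a fixed point theorem or to the joint spectral radius of compact operators. *)

Import Order.TTheory GRing.Theory Num.Theory.
Import numFieldNormedType.Exports.

Set Implicit Arguments.
Unset Strict Implicit.
Unset Printing Implicit Defensive.

Local Open Scope classical_set_scope.
Local Open Scope ring_scope.

(** * Real-valued norms *)

Section RealNorm.
Variables (R : realType) (X : normedModType R[i]).
Implicit Types (x y : X) (r s : R).

Lemma normE (V : normedZmodType R[i]) (v : V) : `|v| = (rnorm v)%:C%C.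
Proof.
have := normr_ge0 v; rewrite lecE /rnorm => /andP[/eqP Im0 _].
by apply/eqP; rewrite eq_complex /= eqxx Im0 /=.
Qed.

Lemma realC_gt0 r : (0 < r%:C%C :> R[i]) = (0 < r).
Proof. exact: (ltcR 0 r). Qed.

Lemma rnorm_ge0 (V : normedZmodType R[i]) (v : V) : 0 <= rnorm v.
Proof. by have := normr_ge0 v; rewrite normE ler0c. Qed.

Lemma rnorm0 : rnorm (0 : X) = 0.
Proof. by rewrite /rnorm normr0. Qed.

Lemma rnorm_eq0 x : (rnorm x == 0) = (x == 0).
Proof. by rewrite -[RHS]normr_eq0 normE -(inj_eq (@complexI R)). Qed.

Lemma rnorm_gt0 x : (0 < rnorm x) = (x != 0).
Proof. by rewrite lt_def rnorm_eq0 rnorm_ge0 andbT. Qed.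

Lemma rnormN x : rnorm (- x) = rnorm x.
Proof. by rewrite /rnorm normrN. Qed.

Lemma rnormBC x y : rnorm (x - y) = rnorm (y - x).
Proof. by rewrite -opprB rnormN. Qed.

Lemma ler_rnormD x y : rnorm (x + y) <= rnorm x + rnorm y.
Proof. by have := ler_normD x y; rewrite !normE -rmorphD/= lecR. Qed.

Lemma ler_rnormB x y : rnorm (x - y) <= rnorm x + rnorm y.
Proof. by rewrite -(rnormN y) ler_rnormD. Qed.

Lemma ler_rnorm_sub x y : rnorm x <= rnorm (x - y) + rnorm y.
Proof. by rewrite -{1}(subrK y x) ler_rnormD. Qed.

Lemma ler_rnorm_via z x y : rnorm (x - y) <= rnorm (x - z) + rnorm (z - y).
Proof. by rewrite -{1}(subrK z x) -addrA ler_rnormD. Qed.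

Lemma ler_rnorm_sum (I : Type) (l : seq I) (P : pred I) (f : I -> X) :
  rnorm (\sum_(i <- l | P i) f i) <= \sum_(i <- l | P i) rnorm (f i).
Proof.
elim/big_rec2 : _ => [|i s y _ ih]; first by rewrite rnorm0.
by rewrite (le_trans (ler_rnormD _ _))// lerD2l.
Qed.

Lemma rnormZ (a : R[i]) x : rnorm (a *: x) = rnorm a * rnorm x.
Proof. by apply: (@complexI R); rewrite rmorphM /= -!normE normrZ. Qed.

Lemma rnorm_real r : rnorm (r%:C%C : R[i]) = `|r|.
Proof. by rewrite /rnorm normc_def /= expr0n /= addr0 sqrtr_sqr. Qed.

Lemma rnormZr r x : rnorm (r%:C%C *: x) = `|r| * rnorm x.
Proof. by rewrite rnormZ rnorm_real. Qed.

Lemma closed_rnorm (M : set X) :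
  (forall z, (forall e, 0 < e -> exists2 y, M y & rnorm (z - y) < e) -> M z) ->
  closed M.
Proof.
move=> HM z clz; apply: HM => e e0.
have /clz [y [My]] : nbhs z (ball z e%:C%C).
  by apply: nbhsx_ballx; rewrite realC_gt0.
by rewrite -ball_normE /= normE ltcR => zy; exists y.
Qed.

Lemma open_rnorm (U : set X) :
  (forall z, U z -> exists2 e, 0 < e & forall y, rnorm (z - y) < e -> U y) ->
  open U.
Proof.
move=> HU; rewrite openE => z /HU[e e0 zeU]; rewrite /interior.
apply/nbhs_ballP; exists e%:C%C => /=; first by rewrite realC_gt0.
by move=> y; rewrite -ball_normE /= normE ltcR => /zeU.
Qed.

Lemma nbhs_rnorm x e : 0 < e -> nbhs x [set y | rnorm (x - y) < e].
Proof.
move=> e0; apply/nbhs_ballP; exists e%:C%C => /=; first by rewrite realC_gt0.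
by move=> y; rewrite -ball_normE /= normE ltcR.
Qed.

End RealNorm.

Lemma cauchy_rnorm (R : realType) (X : completeNormedModType R[i])
    (u : nat -> X) (d : nat -> R) :
  (forall n k, rnorm (u (n + k)%N - u n) <= d n) ->
  (forall e, 0 < e -> exists n, d n < e) ->
  exists l, forall n, rnorm (l - u n) <= d n.
Proof.
move=> ud d0.
have : cauchy (u @ \oo).
  apply/cauchyP => e e0.
  have e0' : (0 : R) < complex.Re e.
    by move: e0; rewrite ltcE => /andP[].
  have ee : e = (complex.Re e)%:C%C.
    move: e0; rewrite ltcE /= => /andP[/eqP ime _].
    by apply/eqP; rewrite eq_complex /= ime !eqxx.
  have [n dn] := d0 _ e0'; exists (u n); exists n => // m /= nm.
  rewrite -ball_normE /= normE ee ltcR rnormBC.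
  by rewrite -(subnKC nm) (le_lt_trans (ud _ _)).
move=> /cauchy_cvgP /= /cvg_ex[l ul]; exists l => n; apply/ler_addgt0Pr => e e0.
have /ul[N _ HN] := nbhs_rnorm l e0.
have := HN (n + N)%N (leq_addl _ _) => /= lt1.
rewrite (le_trans (ler_rnorm_via (u (n + N)%N) _ _))// addrC lerD ?ud//.
exact: ltW.
Qed.

(** * Bounded operators and operator algebras *)

Section BoundedOperators.
Variables (R : realType) (X : normedModType R[i]).
Implicit Types (S T : X -> X) (x y : X) (c d e : R) (A : set (X -> X)).

Section Linear.
Variables (T : X -> X) (linT : linear T).

Lemma lin0 : T 0 = 0.
Proof. by have := linT (-1) 0 0; rewrite scaler0 addr0 scaleN1r addNr. Qed.

Lemma linD x y : T (x + y) = T x + T y.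
Proof. by have := linT 1 x y; rewrite !scale1r. Qed.

Lemma linZ (a : R[i]) x : T (a *: x) = a *: T x.
Proof. by have := linT a x 0; rewrite lin0 !addr0. Qed.

Lemma linB x y : T (x - y) = T x - T y.
Proof. by rewrite linD -scaleN1r linZ scaleN1r. Qed.

Lemma lin_sum (I : Type) (l : seq I) (P : pred I) (f : I -> X) :
  T (\sum_(i <- l | P i) f i) = \sum_(i <- l | P i) T (f i).
Proof.
apply: (big_rec2 (fun u v => T u = v)) => [|i u v _ <-]; first exact: lin0.
by rewrite linD.
Qed.

End Linear.

(** Domination with a real constant replaces the complex constants allowed in
    [bounded_operator]; [opnorm] is the least such constant. *)
Definition dominated c T := forall x, rnorm (T x) <= c * rnorm x.

Lemma dominatedW c d T : c <= d -> dominated c T -> dominated d T.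
Proof. by move=> cd cT x; rewrite (le_trans (cT x))// ler_wpM2r ?rnorm_ge0. Qed.

Lemma dominated_comp c d S T : 0 <= c ->
  dominated c S -> dominated d T -> dominated (c * d) (S \o T).
Proof.
by move=> c0 cS dT x; rewrite (le_trans (cS _))// -mulrA ler_wpM2l.
Qed.

Lemma bounded_operator_lin T : bounded_operator T -> linear T.
Proof. by case. Qed.

Lemma bounded_operatorP T :
  bounded_operator T -> exists2 c, 0 < c & dominated c T.
Proof.
case=> _ [c Tc]; exists (`|complex.Re c| + 1) => [|x].
  by rewrite ltr_wpDl.
have := Tc x; rewrite !normE lecE => /andP[_].
rewrite (_ : complex.Re (c * _) = complex.Re c * rnorm x); last first.
  by case: c {Tc} => a b /=; rewrite mulr0 subr0.
move=> /le_trans; apply; rewrite ler_wpM2r ?rnorm_ge0//.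
by rewrite (le_trans (ler_norm _))// lerDl.
Qed.

Lemma dominated_bounded c T : linear T -> dominated c T -> bounded_operator T.
Proof.
by move=> linT cT; split=> //; exists c%:C%C => x; rewrite !normE -rmorphM lecR.
Qed.

Lemma bounded_operator_id : bounded_operator (idfun : X -> X).
Proof. by apply: (@dominated_bounded 1) => // x; rewrite mul1r. Qed.

Lemma bounded_operatorD S T :
  bounded_operator S -> bounded_operator T -> bounded_operator (S \+ T).
Proof.
move=> bS bT; have [c _ cS] := bounded_operatorP bS.
have [d _ dT] := bounded_operatorP bT.
apply: (@dominated_bounded (c + d)) => [a x y|x] /=.
  by rewrite (bounded_operator_lin bS) (bounded_operator_lin bT) scalerDr addrACA.
by rewrite mulrDl (le_trans (ler_rnormD _ _))// lerD.
Qed.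

Lemma bounded_operatorZ (a : R[i]) T :
  bounded_operator T -> bounded_operator (a \*: T).
Proof.
move=> bT; have [d _ dT] := bounded_operatorP bT.
apply: (@dominated_bounded (rnorm a * d)) => [b x y|x] /=.
  by rewrite (bounded_operator_lin bT) scalerDr !scalerA mulrC.
by rewrite rnormZ -mulrA ler_wpM2l ?rnorm_ge0.
Qed.

Lemma bounded_operator_comp S T :
  bounded_operator S -> bounded_operator T -> bounded_operator (S \o T).
Proof.
move=> bS bT; have [c c0 cS] := bounded_operatorP bS.
have [d _ dT] := bounded_operatorP bT.
apply: (@dominated_bounded (c * d)); last exact: dominated_comp (ltW c0) _ _.
by move=> a x y /=; rewrite (bounded_operator_lin bT) (bounded_operator_lin bS).
Qed.

Lemma closed_kernel T : bounded_operator T -> closed [set x | T x = 0].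
Proof.
move=> bT; have [c c0 cT] := bounded_operatorP bT; apply: closed_rnorm => z zT.
apply/eqP; rewrite -rnorm_eq0 eq_le rnorm_ge0 andbT.
apply/ler_addgt0Pr => e e0; rewrite add0r.
have [|y /= Ty zy] := zT (e / c); first exact: divr_gt0.
rewrite -(subr0 (T z)) -Ty -(linB (bounded_operator_lin bT)).
by rewrite (le_trans (cT _))// mulrC -ler_pdivlMr// ltW.
Qed.

Lemma dominated_unit c T x :
  0 <= c -> dominated c T -> `|x| <= 1 -> rnorm (T x) <= c.
Proof.
rewrite normE lecR => c0 cT x1; rewrite (le_trans (cT x))//.
by rewrite -[leRHS]mulr1 ler_wpM2l.
Qed.

Lemma opnorm_le c T : 0 <= c -> dominated c T -> opnorm T <= c.
Proof.
move=> c0 cT; rewrite /opnorm; apply: ge_sup.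
  by exists (rnorm (T 0)); exists 0 => //=; rewrite normr0.
move=> _ [x /= x1 <-]; exact: dominated_unit.
Qed.

Lemma dominated_opnorm T : bounded_operator T -> dominated (opnorm T) T.
Proof.
move=> bT x; have [c c0 cT] := bounded_operatorP bT.
have [->|x0] := eqVneq x 0.
  by rewrite (lin0 (bounded_operator_lin bT)) rnorm0 mulr0.
have nx0 : 0 < rnorm x by rewrite rnorm_gt0.
rewrite -ler_pdivrMr//; apply: ub_le_sup.
  by exists c => _ [y /= y1 <-]; exact: dominated_unit (ltW c0) _ _.
exists ((rnorm x)^-1%:C%C *: x) => /=.
  rewrite normE rnormZr ger0_norm ?invr_ge0 ?rnorm_ge0//.
  by rewrite mulVf ?gt_eqF.
rewrite (linZ (bounded_operator_lin bT)) rnormZr.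
by rewrite ger0_norm ?invr_ge0 ?rnorm_ge0// mulrC.
Qed.

Lemma opnorm_ge0 T : bounded_operator T -> 0 <= opnorm T.
Proof.
move=> bT; have [c c0 cT] := bounded_operatorP bT.
apply: (@le_trans _ _ (rnorm (T 0))); first exact: rnorm_ge0.
apply: ub_le_sup; last by exists 0 => //=; rewrite normr0.
by exists c => _ [y /= y1 <-]; exact: dominated_unit (ltW c0) _ _.
Qed.

Lemma norm_closedP A T : norm_closed A -> bounded_operator T ->
  (forall e, 0 < e -> exists2 S, A S & dominated e (T \- S)) -> A T.
Proof.
move=> clA bT HT; apply: (clA _ bT) => e e0.
have [|S AS TS] := HT (e / 2); first by rewrite divr_gt0.
exists S => //; apply: (@le_lt_trans _ _ (e / 2)); last by lra.
by apply: opnorm_le => //; rewrite ltW// divr_gt0.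
Qed.

End BoundedOperators.

Section OperatorAlgebra.
Variables (R : realType) (X : normedModType R[i]) (A : set (X -> X)).
Hypothesis algA : operator_algebra A.
Implicit Types (S T : X -> X).

Lemma alg_bounded T : A T -> bounded_operator T.
Proof. by case: algA => + _ _ _ _; apply. Qed.

Lemma alg_lin T : A T -> linear T.
Proof. by move=> /alg_bounded []. Qed.

Lemma alg0 : A (cst 0).
Proof. by case: algA. Qed.

Lemma algD S T : A S -> A T -> A (S \+ T).
Proof. by case: algA => _ _ + _ _; apply. Qed.

Lemma algZ (a : R[i]) T : A T -> A (a \*: T).
Proof. by case: algA => _ _ _ + _; apply. Qed.

Lemma alg_comp S T : A S -> A T -> A (S \o T).
Proof. by case: algA => _ _ _ _; apply. Qed.

Lemma alg_iter n T : A T -> A (iter n.+1 T).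
Proof.
move=> AT; elim: n => // n; exact: alg_comp.
Qed.

Lemma alg_sum (I : Type) (l : seq I) (F : I -> X -> X) :
  (forall i, A (F i)) -> A (fun x => \sum_(i <- l) F i x).
Proof.
move=> AF; elim: l => [|i l ih].
  rewrite (_ : (fun _ => _) = cst 0); first exact: alg0.
  by apply/funext => x; rewrite big_nil.
rewrite (_ : (fun _ => _) = F i \+ (fun x => \sum_(i <- l) F i x)).
  exact: algD.
by apply/funext => x; rewrite big_cons.
Qed.

Lemma commutant_bounded T : commutant A T -> bounded_operator T.
Proof. by case. Qed.

Lemma commutantE S T x : commutant A S -> A T -> S (T x) = T (S x).
Proof. by case=> _ ST /ST /(congr1 (@^~ x)). Qed.

Lemma commutant_id : commutant A idfun.
Proof. by split; [exact: bounded_operator_id|]. Qed.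

Lemma commutantZ (a : R[i]) T : commutant A T -> commutant A (a \*: T).
Proof.
move=> cT; split=> [|S AS]; first exact: bounded_operatorZ (proj1 cT).
by apply/funext => x /=; rewrite (commutantE _ cT AS) (linZ (alg_lin AS)).
Qed.

Lemma commutant_comp S T :
  commutant A S -> commutant A T -> commutant A (S \o T).
Proof.
move=> cS cT; split=> [|B AB].
  exact: bounded_operator_comp (proj1 cS) (proj1 cT).
by apply/funext => x /=; rewrite (commutantE _ cT AB) (commutantE _ cS AB).
Qed.

End OperatorAlgebra.

(** * Fixed points, nilpotency and sandwiches *)

Lemma quasinilpotent_fixpoint (R : realType) (X : normedModType R[i])
    (T : X -> X) x : quasinilpotent T -> T x = x -> x = 0.
Proof.
move=> qT Tx; have : ~ spectrum T 1.
  move=> s1; have : ((rnorm (1 : R[i]))%:E <= spectral_radius T)%E.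
    by apply: ereal_sup_ubound; exists 1.
  by rewrite qT /rnorm normr1 /= lee_fin ler10.
move=> /contrapT[S [bS /(congr1 (@^~ x)) + _]].
have -> : (S \o (T \- 1 \*: idfun)) x = S 0.
  by congr (S _); rewrite /= scale1r Tx subrr.
by rewrite (lin0 (bounded_operator_lin bS)).
Qed.

(** Continuity of [T |-> T^n w] in operator norm, with a linear modulus near [S]. *)
Lemma iter_perturb (R : realType) (X : normedModType R[i]) (S : X -> X)
    (c : R) n w : linear S -> 0 <= c -> dominated c S ->
  exists2 C, 0 <= C & forall (d : R) T, 0 <= d <= 1 -> dominated d (T \- S) ->
    rnorm (iter n T w - iter n S w) <= C * d.
Proof.
move=> linS c0 cS; elim: n => [|n [C C0 ih]].
  by exists 0 => // d T _ _ /=; rewrite subrr rnorm0 mul0r.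
exists (rnorm (iter n S w) + C + c * C) => [|d T /[dup] d01 /andP[d0 d1] dTS].
  by rewrite !addr_ge0 ?rnorm_ge0// mulr_ge0.
rewrite /= (le_trans (ler_rnorm_via (S (iter n T w)) _ _))// mulrDl lerD//.
  rewrite (le_trans (dTS _))// mulrC ler_wpM2r//.
  rewrite (le_trans (ler_rnorm_sub _ (iter n S w)))// addrC lerD2l.
  by rewrite (le_trans (ih d T d01 dTS))// -[leRHS]mulr1 ler_wpM2l.
by rewrite -(linB linS) (le_trans (cS _))// -mulrA ler_wpM2l// ih.
Qed.

Section FixpointFreeAlgebra.
Variables (R : realType) (X : normedModType R[i]) (A : set (X -> X)).
Hypothesis algA : operator_algebra A.
Hypothesis fixA : forall T x, A T -> T x = x -> x = 0.

(** Let [c i] be the first non-zero coefficient.  After division by [c i] the relation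
    says that [T^(i+1) x] is fixed by an operator of [A], hence is zero. *)
Lemma relation_iter_eq0 T (q : nat) (c : nat -> R[i]) x : A T ->
  (exists2 i, (i < q)%N & c i != 0) ->
  \sum_(i < q) c i *: iter i.+1 T x = 0 -> iter q T x = 0.
Proof.
move=> AT; have linT := alg_lin algA AT.
elim: q c x => [c x []//|q ih c x [i iq ci0]].
rewrite big_ord_recl [X in _ + X](_ : _ =
  \sum_(i < q) c i.+1 *: iter i.+1 T (T x)); last first.
  by apply: eq_bigr => j _; rewrite lift0 [iter j.+2 T x]iterSr.
have [c00|c00] := eqVneq (c 0%N) 0.
  rewrite c00 scale0r add0r iterSr => /(ih (fun j => c j.+1)); apply.
  by case: i iq ci0 => [|i iq ci0]; [rewrite c00 eqxx|exists i].
move=> /(congr1 (fun z => (c 0%N)^-1 *: z)).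
rewrite scaler0 scalerDr scalerA mulVf// scale1r => /eqP.
rewrite addr_eq0 => /eqP Tx.
have Tx0 : T x = 0.
  apply: (@fixA ((- (c 0%N)^-1) \*: (fun y => \sum_(i < q) (c i.+1) *: iter i.+1 T y))).
    apply: (algZ algA); apply: (alg_sum algA) => j.
    exact: (algZ algA (c j.+1) (alg_iter algA j AT)).
  by rewrite /= scaleNr -Tx.
by rewrite iterSr Tx0; elim: q {ih iq Tx} => //= q ->; exact: lin0.
Qed.

(** If [D z] vanishes identically for all [z] in [A], the kernel of [D] contains
    all ranges of [A]; otherwise the common kernel of the [D z] contains the range
    of [D].  Both kernels are invariant under [A] and its commutant. *)
Lemma sandwich_hyperinvariant D : A D -> D <> cst 0 ->
  (forall z v, A z -> D (z (D v)) = 0) ->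
  exists M : set X, nontrivial_subspace M /\ hyperinvariant A M.
Proof.
move=> AD D0 Dz; have linD' := alg_lin algA AD.
have [v Dv] : exists v, D v <> 0.
  apply: contrapT => /forallNP Dv; apply: D0; apply/funext => x.
  exact: contrapT (Dv x).
have [DA|] := pselect (forall z x, A z -> D (z x) = 0).
  exists [set x | D x = 0]; split.
    split.
    - split; first exact: closed_kernel (alg_bounded algA AD).
        exact: lin0.
      by move=> a x y /= Dx Dy; rewrite linD' Dx Dy scaler0 addr0.
    - move=> kD0; apply: Dv.
      by have : [set x | D x = 0] (D v) by [exact: DA]; rewrite kD0.
    - by move=> kD; have : [set x | D x = 0] v by rewrite kD.
  move=> T TA _ [x /= Dx <-]; case: TA => [AT|cT]; first exact: DA.
  by rewrite -(commutantE _ cT AD) Dx (lin0 (bounded_operator_lin (proj1 cT))).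
move=> /existsNP[z0 /existsNP[x0 /not_implyP[Az0 Dzx0]]].
exists [set x | forall z, A z -> D (z x) = 0]; split.
  split.
  - split.
    + rewrite (_ : [set _ | _] = \bigcap_(z in A) [set x | (D \o z) x = 0]).
        apply: closed_bigI => z Az; apply: closed_kernel.
        exact: alg_bounded (alg_comp algA AD Az).
      by apply/seteqP; split=> x Hx z; exact: Hx.
    + by move=> z Az; rewrite (lin0 (alg_lin algA Az)) lin0.
    + move=> a x y Hx Hy z Az.
      by rewrite (alg_lin algA Az) linD' Hx// Hy// scaler0 addr0.
  - move=> k0; apply: Dv.
    have : [set x | forall z, A z -> D (z x) = 0] (D v) by move=> z; exact: Dz.
    by rewrite k0.
  - move=> kT; apply: Dzx0.
    by move: (I : [set: X] x0); rewrite -kT => /(_ z0 Az0).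
move=> T TA _ [x /= Hx <-] z Az; case: TA => [AT|cT].
  exact: Hx (alg_comp algA Az AT).
rewrite -(commutantE _ cT Az) -(commutantE _ cT AD) Hx//.
exact: lin0 (bounded_operator_lin (proj1 cT)).
Qed.

Lemma iter_limit_eq0 (S T : X -> X) (d : R) n w : bounded_operator S ->
  bounded_operator T -> 0 < d ->
  (forall t, 0 < t -> t < d -> iter n (S \+ t%:C%C \*: T) w = 0) ->
  iter n S w = 0.
Proof.
move=> bS bT d0 St0; have [c c0 cS] := bounded_operatorP bS.
have [e e0 eT] := bounded_operatorP bT.
have [C C0 HC] := iter_perturb n w (bounded_operator_lin bS) (ltW c0) cS.
apply/eqP; rewrite -rnorm_eq0 eq_le rnorm_ge0 andbT.
apply/ler_addgt0Pr => r r0; rewrite add0r.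
pose t := Num.min (d / 2) (Num.min e^-1 (r / (C + 1) / e)).
have C10 : 0 < C + 1 by rewrite ltr_wpDl.
have t0 : 0 < t by rewrite !lt_min divr_gt0// invr_gt0 e0/= !divr_gt0.
have td : t < d.
  by rewrite (@le_lt_trans _ _ (d / 2)) ?ge_min ?lexx//; lra.
have te : t * e <= 1.
  by rewrite -ler_pdivlMr// mul1r !ge_min lexx orbT.
have tr : t * e <= r / (C + 1).
  by rewrite -ler_pdivlMr// !ge_min lexx !orbT.
have := HC (t * e) (S \+ t%:C%C \*: T).
rewrite St0// sub0r rnormN => H; apply: le_trans (H _ _) _.
- by rewrite te mulr_ge0// ltW.
- move=> x /=; rewrite addrAC subrr add0r rnormZr gtr0_norm//.
  by rewrite -mulrA ler_wpM2l// ltW.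
- apply: (@le_trans _ _ ((C + 1) * (t * e))).
    by rewrite ler_wpM2r// ?lerDl// mulr_ge0// ltW.
  by rewrite mulrC -ler_pdivlMr.
Qed.

(** For [T = idfun] this is the sandwich step of Levitzki's theorem on nil algebras
    of bounded index.  Take the index [n + 1] minimal over all balls, so that
    [D = (T x)^n T] is non-zero for some [x] in the ball, and let [u] be in the range
    of [D], so that [T x u = 0].  Then
    [0 = (T (x + t z))^(n+1) u = t (T (x + t z))^n (T z u)]; divide by [t] and
    let [t] tend to 0. *)
Lemma nil_ball_sandwich T S (e : R) n :
  bounded_operator T ->
  (forall B, A B -> A (T \o B)) -> (forall B, A B -> A (T \o B \o T)) ->
  (exists2 B, A B & T \o B \o T <> cst 0) ->
  A S -> 0 < e ->
  (forall B v, A B -> dominated e (B \- S) -> iter n (T \o B) (T v) = 0) ->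
  exists D, [/\ A D, D <> cst 0 & forall z v, A z -> D (z (D v)) = 0].
Proof.
move=> bT TA TAT [B0 AB0 TBT0] AS.
have linT := bounded_operator_lin bT.
have line (B z : X -> X) (d : R) : 0 < d -> A B -> A z ->
    dominated (d / 2) (B \- S) -> exists2 r, 0 < r &
    forall t, 0 < t -> t < r ->
      A (B \+ t%:C%C \*: z) /\ dominated d ((B \+ t%:C%C \*: z) \- S).
  move=> d0 AB Az dB; have [b b0 bz] := bounded_operatorP (alg_bounded algA Az).
  exists (d / 2 / b) => [|t t0]; first by rewrite !divr_gt0.
  rewrite ltr_pdivlMr// => td; split.
    exact: (algD algA AB (algZ algA _ Az)).
  move=> x /=; rewrite addrAC (le_trans (ler_rnormD _ _))//.
  rewrite rnormZr gtr0_norm// (splitr d) mulrDl lerD//; first exact: dB.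
  rewrite (@le_trans _ _ (t * (b * rnorm x)))// ?ler_wpM2l ?(ltW t0)//.
  by rewrite mulrA ler_wpM2r ?rnorm_ge0// ltW.
have S2 (d : R) : 0 < d -> dominated d (S \- S).
  by move=> d0 x /=; rewrite subrr rnorm0 mulr_ge0 ?rnorm_ge0 ?ltW.
elim: n e => [|n ih] e e0 nilB.
  exfalso; apply: TBT0; apply/funext => v /=.
  by have /= := nilB _ (B0 (T v)) AS (S2 _ e0).
have e20 : 0 < e / 2 by rewrite divr_gt0.
have [[x [v [Ax dx nx]]]|small] := pselect (exists x v,
    [/\ A x, dominated (e / 2) (x \- S) & iter n (T \o x) (T v) <> 0]); last first.
  apply: (ih (e / 2)) => // B v AB dB; apply: contrapT => nB.
  by apply: small; exists B, v.
(* When the index is [1], [D = T] need not belong to [A]; but then [T B T] vanishes on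
   a ball of [A], hence on [A]. *)
case: n {ih} nilB nx => [nilB _|n nilB nx].
  exfalso; apply: TBT0; apply/funext => w /=.
  have [r r0 /(_ (r / 2))[||AB dB]] := line _ _ _ e0 AS AB0 (S2 _ e20).
  - exact: divr_gt0.
  - by rewrite ltr_pdivrMr// ltr_pMr// ltr1n.
  have /= := nilB _ w AB dB; rewrite (linD linT).
  have /= -> := nilB _ w AS (S2 _ e0); rewrite add0r (linZ linT) => /eqP.
  rewrite scaler_eq0 => /orP[/eqP/(congr1 (@complex.Re R)) /=|/eqP TBT].
    by move=> /eqP; rewrite gt_eqF// divr_gt0.
  exact: TBT.
exists (iter n.+1 (T \o x) \o T); split.
- rewrite (_ : _ \o T = iter n (T \o x) \o (T \o x \o T)); last first.
    by apply/funext => y /=; rewrite -iterSr.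
  case: n {nilB nx} => [|n]; first exact: TAT.
  exact: (alg_comp algA (alg_iter algA n (TA _ Ax)) (TAT _ Ax)).
- by move=> /(congr1 (@^~ v)).
move=> z w Az; set u := (_ \o T) w; have Az' := alg_comp algA Az.
have Xu : T (x u) = 0 by apply: (nilB x w Ax); apply: dominatedW dx; lra.
have [u' Tu'] : exists u', u = T u'.
  by exists (x (iter n (T \o x) (T w))).
have [r r0 Hr] := line _ _ _ e0 Ax Az dx.
apply: (@iter_limit_eq0 (T \o x) (T \o z) r n.+1 (T (z u))) => //.
- exact: bounded_operator_comp bT (alg_bounded algA Ax).
- exact: bounded_operator_comp bT (alg_bounded algA Az).
move=> t t0 tr; have [AB dB] := Hr t t0 tr.
have := nilB _ u' AB dB; rewrite -Tu' iterSr.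
rewrite (_ : (_ \o _) u = t%:C%C *: T (z u)); last first.
  by rewrite /= (linD linT) Xu add0r (linZ linT).
rewrite (_ : T \o _ = T \o x \+ t%:C%C \*: (T \o z)); last first.
  by apply/funext => y /=; rewrite (linD linT) (linZ linT).
have linY : linear (iter n.+1 (T \o x \+ t%:C%C \*: (T \o z))).
  apply: (alg_lin algA); apply: (alg_iter algA).
  exact: (algD algA (TA _ Ax) (algZ algA _ (TA _ Az))).
rewrite (linZ linY) => /eqP; rewrite scaler_eq0 => /orP[|/eqP//].
by rewrite (inj_eq (@complexI R) t 0) gt_eqF.
Qed.

(** The case of a non-zero finite-rank operator, finite rank being expressed as
    the linear dependence of any [q] values.  For [B] in [A], the vectors
    [(T B)^i x] with [0 < i <= q] are values of [T], hence dependent, so [T B] is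
    nilpotent of index at most [q]. *)
Lemma finite_rank_hyperinvariant T q : A T -> T <> cst 0 ->
  (forall x : 'I_q -> X, exists2 c : 'I_q -> R[i],
     exists i, c i != 0 & \sum_(i < q) c i *: T (x i) = 0) ->
  exists M : set X, nontrivial_subspace M /\ hyperinvariant A M.
Proof.
move=> AT T0 depT.
have [[B AB TBT]|TAT] := pselect (exists2 B, A B & T \o B \o T <> cst 0); last first.
  apply: (sandwich_hyperinvariant AT T0) => z v Az; apply: contrapT => TzT.
  by apply: TAT; exists z => // /(congr1 (@^~ v)).
have [|D [AD D0 Dz]] := @nil_ball_sandwich T (cst 0) 1 q
    (alg_bounded algA AT) (fun B AB => alg_comp algA AT AB)
    (fun B AB => alg_comp algA (alg_comp algA AT AB) AT)
    (ex_intro2 _ _ B AB TBT) (alg0 algA) ltr01; last first.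
- exact: sandwich_hyperinvariant AD D0 Dz.
move=> {AB TBT}B v AB _.
have [c [i ci] sumc] := depT (fun i => B (iter i (T \o B) (T v))).
pose c' j := oapp c 0 (insub j).
have c'E (j : 'I_q) : c' j = c j.
  by rewrite /c' insubT//= => ?; congr (c _); exact/val_inj.
apply: (@relation_iter_eq0 _ _ c' _ (alg_comp algA AT AB)).
  by exists i; rewrite ?c'E.
by rewrite -[RHS]sumc; apply: eq_bigr => j _; rewrite c'E.
Qed.

Lemma horner_iter_eq0 T (p : {poly R[i]}) : A T -> p != 0 ->
  T \o op_horner p T = cst 0 -> forall x, iter (size p) T x = 0.
Proof.
move=> AT p0 Tp x; apply: (@relation_iter_eq0 _ _ (fun j => p`_j) _ AT).
  exists (size p).-1; first by rewrite prednK// size_poly_gt0.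
  by rewrite -lead_coefE lead_coef_eq0.
have /= := congr1 (@^~ x) Tp; rewrite /op_horner (lin_sum (alg_lin algA AT)).
move=> sum0; rewrite -[RHS]sum0; apply: eq_bigr => i _.
by rewrite (linZ (alg_lin algA AT)).
Qed.

End FixpointFreeAlgebra.

(** * Nil algebras and the category argument *)

Lemma expr2_unbounded (R : realType) (r : R) : exists n, r < 2 ^+ n.
Proof.
exists (Num.bound `|r|); rewrite (le_lt_trans (ler_norm r))//.
rewrite (lt_trans (archi_boundP (normr_ge0 r)))// -natrX ltr_nat.
exact: ltn_expl.
Qed.

Section Limits.
Variables (R : realType).

Lemma uniform_limit_bounded (X : normedModType R[i]) (T : X -> X) :
  (forall e : R, 0 < e -> exists2 S, bounded_operator S & dominated e (T \- S)) ->
  bounded_operator T.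
Proof.
move=> TS; have [S1 bS1 TS1] := TS _ ltr01.
have [c c0 cS1] := bounded_operatorP bS1.
apply: (@dominated_bounded _ _ (1 + c)) => [a x y|x]; last first.
  by rewrite (le_trans (ler_rnorm_sub _ (S1 x)))// mulrDl lerD//; exact: TS1.
apply/eqP; rewrite -subr_eq0 -rnorm_eq0 eq_le rnorm_ge0 andbT.
set N := rnorm (a *: x + y) + (rnorm a * rnorm x + rnorm y).
have N0 : 0 < N + 1 by rewrite ltr_wpDl// !addr_ge0 ?mulr_ge0 ?rnorm_ge0.
apply/ler_addgt0Pr => r r0; rewrite add0r.
have [|S [linS _] eS] := TS (r / (N + 1)); first exact: divr_gt0.
have -> : T (a *: x + y) - (a *: T x + T y) =
    (T \- S) (a *: x + y) - (a *: (T \- S) x + (T \- S) y).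
  rewrite /= linS scalerBr addrACA -opprD [in RHS]opprB.
  by rewrite [RHS]addrA subrK.
apply: (@le_trans _ _ (r / (N + 1) * N)).
  set d := r / (N + 1) in eS *; rewrite /N mulrDr.
  rewrite (le_trans (ler_rnormB _ _))// lerD//.
  rewrite mulrDr (le_trans (ler_rnormD _ _))// lerD//.
  by rewrite rnormZ mulrCA ler_wpM2l ?rnorm_ge0.
rewrite -[leRHS]mulr1 -mulrA ler_wpM2l ?(ltW r0)// mulrC ler_pdivrMr// mul1r.
by rewrite lerDl.
Qed.

Variables (X : completeNormedModType R[i]) (A : set (X -> X)).
Hypothesis algA : operator_algebra A.
Hypothesis closedA : norm_closed A.

Lemma alg_uniform_limit T :
  (forall e : R, 0 < e -> exists2 S, A S & dominated e (T \- S)) -> A T.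
Proof.
move=> TS; apply: norm_closedP => //; apply: uniform_limit_bounded => e e0.
by have [S AS eS] := TS e e0; exists S => //; exact: alg_bounded AS.
Qed.

Lemma alg_cauchy (S : nat -> X -> X) (d : nat -> R) : (forall n, A (S n)) ->
  (forall n k, dominated (d n) (S (n + k)%N \- S n)) ->
  (forall e, 0 < e -> exists n, d n < e) ->
  exists2 T, A T & forall n, dominated (d n) (T \- S n).
Proof.
move=> AS dS d0.
have : forall x, exists l, forall n, rnorm (l - S n x) <= d n * rnorm x.
  move=> x; apply: (@cauchy_rnorm _ _ _ (fun n => d n * rnorm x)).
    by move=> n k; exact: dS.
  move=> e e0; have x1 : 0 < rnorm x + 1 by rewrite ltr_wpDl ?rnorm_ge0.
  have [|n dn] := d0 (e / (rnorm x + 1)); first by rewrite divr_gt0.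
  have [d_le0|d_gt0] := leP (d n) 0; exists n.
    by rewrite (le_lt_trans _ e0)// mulr_le0_ge0 ?rnorm_ge0.
  move: dn; rewrite ltr_pdivlMr//; apply: le_lt_trans.
  by rewrite ler_wpM2l ?(ltW d_gt0)// lerDl.
move=> /choice[T dT]; exists T => [|n x]; last exact: dT.
apply: alg_uniform_limit => e e0; have [n dn] := d0 _ e0.
by exists (S n) => // x; rewrite (le_trans (dT _ _))// ler_wpM2r ?rnorm_ge0// ltW.
Qed.

(** A Baire category argument: if every ball contains operators whose [n]-th power
    is non-zero, for every [n], then nested balls shrink to an operator none of
    whose powers vanishes. *)
Lemma nil_algebra_ball :
  (forall T, A T -> exists n, forall x, iter n T x = 0) ->
  exists S (e : R) n, [/\ A S, 0 < e &
    forall B v, A B -> dominated e (B \- S) -> iter n B v = 0].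
Proof.
move=> nilA; apply: contrapT => noball.
have escape S (e : R) n : A S -> 0 < e ->
    exists B v, [/\ A B, dominated e (B \- S) & iter n B v <> 0].
  move=> AS e0; apply: contrapT => noB; apply: noball; exists S, e, n.
  split=> // B v AB eB; apply: contrapT => Bv.
  by apply: noB; exists B, v.
have step (p : nat * ((X -> X) * R)) : exists q : (X -> X) * R,
    A p.2.1 -> 0 < p.2.2 -> [/\ A q.1, 0 < q.2, q.2 <= p.2.2 / 2,
      dominated (p.2.2 / 2) (q.1 \- p.2.1) & forall T, dominated q.2 (T \- q.1) ->
      exists v, iter p.1 T v <> 0].
  case: p => n [S e]; have [[AS e0]|nSe] := pselect (A S /\ 0 < e); last first.
    by exists (S, e) => /= *; case: nSe.
  have [|B [v [AB eB Bv]]] := escape S (e / 2) n AS; first exact: divr_gt0.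
  have [c c0 cB] := bounded_operatorP (alg_bounded algA AB).
  have [C C0 HC] := iter_perturb n v (alg_lin algA AB) (ltW c0) cB.
  have a0 : 0 < rnorm (iter n B v) by rewrite rnorm_gt0; exact/eqP.
  pose a := rnorm (iter n B v) / 2 / (C + 1).
  have C1 : 0 < C + 1 by rewrite ltr_wpDl.
  pose d := Num.min (e / 2) (Num.min 1 a).
  have d0 : 0 < d by rewrite !lt_min ltr01 divr_gt0//= divr_gt0// divr_gt0.
  exists (B, d) => /= _ _; split => //; first by rewrite ge_min lexx.
  move=> T dT; exists v => Tv; have := HC d T; rewrite Tv sub0r rnormN.
  move=> /(_ _ dT); rewrite (ltW d0) !ge_min lexx orbT => /(_ isT).
  apply/negP; rewrite -ltNge.
  apply: (@le_lt_trans _ _ (C * a)); first by rewrite ler_wpM2l// !ge_min lexx !orbT.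
  apply: (@le_lt_trans _ _ ((C + 1) * a)).
    by rewrite ler_wpM2r// ?lerDl// ltW// divr_gt0// divr_gt0.
  by rewrite /a mulrC divfK ?gt_eqF//; lra.
(* The radii are at least halved at each step, so that the limit stays in all balls. *)
have [F HF] := choice step.
pose s := nat_rect (fun=> ((X -> X) * R)%type) (cst 0, 1) (fun n p => F (n, p)).
have As n : A (s n).1 /\ 0 < (s n).2.
  elim: n => [|n [An sn0]]; first by split; [exact: alg0|exact: ltr01].
  by have [] := HF (n, s n) An sn0.
have sS n := HF (n, s n) (proj1 (As n)) (proj2 (As n)).
have s2 n : (s n).2 <= 2^-1 ^+ n.
  elim: n => [|n ih]; first by rewrite expr0.
  have [_ _ + _ _] := sS n; move=> /le_trans; apply.
  by rewrite exprSr ler_wpM2r// invr_ge0.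
have [||T AT sT] := @alg_cauchy (fun n => (s n).1) (fun n => (s n).2)
    (fun n => proj1 (As n)).
- move=> n k; elim: k n => [|k ih] n x /=.
    by rewrite addn0 subrr rnorm0 mulr_ge0 ?rnorm_ge0// ltW//; exact: (proj2 (As n)).
  rewrite addnS -addSn (le_trans (ler_rnorm_via ((s n.+1).1 x) _ _))//.
  have [_ _ e2 /(_ x) /= d2 _] := sS n.
  rewrite (le_trans (lerD (ih n.+1 x) d2))//= -mulrDl ler_wpM2r ?rnorm_ge0//.
  by rewrite [leRHS]splitr lerD.
- move=> e e0; have [n ne] := expr2_unbounded e^-1; exists n.
  rewrite (le_lt_trans (s2 n))// exprVn invf_plt ?posrE//.
have [n Tn] := nilA _ AT; have [_ _ _ _ /(_ T)] := sS n.
by case=> [|v]; [exact: (sT n.+1)|rewrite /= Tn].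
Qed.

End Limits.

(** * Compact operators *)

Section CompactOperators.
Variables (R : realType) (X : normedModType R[i]).
Implicit Types (T S : X -> X) (x y : X) (r e : R).

Lemma nbhs_rnormP x (U : set X) :
  nbhs x U -> exists2 e : R, 0 < e & forall y, rnorm (x - y) < e -> U y.
Proof.
move=> /nbhs_ballP[e /= e0 eU]; move: e0; rewrite ltcE => /andP[/eqP ime ree].
exists (complex.Re e) => // y xy; apply: eU; rewrite -ball_normE /= normE ltcE /=.
by rewrite xy ime eqxx.
Qed.

Lemma bounded_continuous T : bounded_operator T -> continuous T.
Proof.
move=> bT x U /nbhs_rnormP[e e0 eU]; have [c c0 cT] := bounded_operatorP bT.
have /(nbhs_rnorm x) : 0 < e / c by rewrite divr_gt0.
rewrite /nbhs /=; apply: filterS => y /= xy; apply: eU.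
rewrite -(linB (bounded_operator_lin bT)) (le_lt_trans (cT _))//.
by rewrite mulrC -ltr_pdivlMr.
Qed.

Lemma compact_operator_comp S T :
  bounded_operator S -> compact_operator T -> compact_operator (S \o T).
Proof.
move=> bS [bT pT]; split; first exact: bounded_operator_comp.
apply: (@precompact_subset _ _ (S @` closure (T @` [set x | `|x| <= 1]))).
  by move=> _ [x x1 <-]; exists (T x) => //; apply: subset_closure; exists x.
apply: compact_precompact; first exact: norm_hausdorff.
apply: continuous_compact; last by rewrite -precompactE.
by apply: continuous_subspaceT; exact: bounded_continuous.
Qed.

(** [#|I|] bounds a covering number of the image of the unit ball; indexing the
    centres by a finite type makes compositions correspond to products of types. *)
Definition covered (I : finType) r T :=
  exists Y : I -> X, forall x, rnorm x <= 1 -> exists i, rnorm (T x - Y i) <= r.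

Lemma compact_covered T r : compact_operator T -> 0 < r ->
  exists I : finType, covered I r T.
Proof.
move=> [_]; rewrite precompactE compact_cover => cT r0.
have [||D _ DT] := cT X setT (fun y => [set z | rnorm (z - y) < r]).
- move=> y _; apply: open_rnorm => z zy; exists (r - rnorm (z - y)).
    by rewrite subr_gt0.
  move=> z'; rewrite ltrBrDr => zz' /=; apply: le_lt_trans zz'.
  by rewrite (rnormBC z z') ler_rnorm_via.
- by move=> z _; exists z => //=; rewrite subrr rnorm0.
exists (fset_sub_type D : finType), (fun y : fset_sub_type D => fsval y) => x x1.
have [|y /= yD xy] := DT (T x).
  by apply: subset_closure; exists x => //=; rewrite normE lecR.
by exists [` yD]%fset; exact: ltW.
Qed.

Lemma covered_idfun : covered unit 1 idfun.
Proof. by exists (fun=> 0) => x x1; exists tt; rewrite subr0. Qed.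

Lemma covered_comp (I J : finType) r s S T : linear S -> 0 < s ->
  covered I r S -> covered J s T -> covered (I * J)%type (r * s) (S \o T).
Proof.
move=> linS s0 [Y SY] [Z TZ].
exists (fun p => s%:C%C *: Y p.1 + S (Z p.2)) => x /TZ[j xj].
have [|i ij] := SY (s^-1%:C%C *: (T x - Z j)).
  by rewrite rnormZr gtr0_norm ?invr_gt0// ler_pdivrMl// mulr1.
exists (i, j); rewrite [X in rnorm X](_ : _ =
  s%:C%C *: (S (s^-1%:C%C *: (T x - Z j)) - Y i)).
  by rewrite rnormZr gtr0_norm// mulrC ler_wpM2r// ltW.
rewrite (linZ linS) scalerBr scalerA -rmorphM /= mulfV ?gt_eqF// scale1r.
by rewrite (linB linS) opprD addrA addrAC.
Qed.

(** Each operator in [P] moves an open set of vectors close to [x0], and the vectors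
    of norm at least [d] in the closed image of the unit ball form a compact set. *)
Lemma compact_operator_selection K (P : set (X -> X)) x0 d e :
  compact_operator K -> (forall B, P B -> bounded_operator B) ->
  (forall y, d <= rnorm y -> exists2 B, P B & rnorm (B y - x0) < e) ->
  exists (J : finType) (B : J -> X -> X), (forall j, P (B j)) /\
    forall x, rnorm x <= 1 -> d <= rnorm (K x) ->
      exists j, rnorm (B j (K x) - x0) < e.
Proof.
move=> [_]; rewrite precompactE => cK bP PB.
have /choice[B HB] : forall y, exists B,
    d <= rnorm y -> P B /\ rnorm (B y - x0) < e.
  move=> y; have [/PB[B PBB yB]|] := pselect (d <= rnorm y); first by exists B.
  by exists idfun.
have cl : closed [set y : X | d <= rnorm y].
  apply: closed_rnorm => z Hz /=; apply/ler_addgt0Pr => t t0.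
  have [y /= dy zy] := Hz t t0; rewrite (le_trans dy)//.
  by rewrite (le_trans (ler_rnorm_sub _ z))// addrC lerD2l rnormBC ltW.
have := compact_closedI cK cl; rewrite compact_cover => cover.
have [||D Dd DK] := cover X [set y | d <= rnorm y]
    (fun y => [set z | rnorm (B y z - x0) < e]).
- move=> y dy; apply: open_rnorm => z zy /=.
  have bB := bP _ (proj1 (HB y dy)); have [c c0 cB] := bounded_operatorP bB.
  exists ((e - rnorm (B y z - x0)) / c) => [|w].
    by rewrite divr_gt0// subr_gt0.
  rewrite ltr_pdivlMr// ltrBrDr => zw; apply: le_lt_trans zw.
  rewrite (le_trans (ler_rnorm_via (B y z) _ _))// lerD2r.
  rewrite -(linB (bounded_operator_lin bB)) (le_trans (cB _))//.
  by rewrite mulrC rnormBC.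
- by move=> z [_ dz]; exists z => //=; have [] := HB z dz.
exists (fset_sub_type D : finType), (fun y : fset_sub_type D => B (fsval y)); split.
  by move=> y; have := Dd _ (valP y); rewrite inE => /HB[].
move=> x x1 dKx; have [|y /= yD xy] := DK (K x).
  split=> //; apply: subset_closure; exists x => //=; rewrite normE.
  by rewrite lecR.
by exists [` yD]%fset.
Qed.

(** An ultrafilter finer than the neighbourhoods of infinity gives limits of
    [T (S n y)] for all [y] at once, so that finitely many of them are approximated by
    a common [n]. *)
Lemma compact_pointwise_limit T (S : nat -> X -> X) (c : R) :
  compact_operator T -> (forall n, dominated c (S n)) ->
  exists L : X -> X, forall (s : seq X) e N, 0 < e ->
    exists2 n, (N <= n)%N & {in s, forall y, rnorm (L y - T (S n y)) < e}.
Proof.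
move=> [bT]; rewrite precompactE => cT cS.
have [U [UU sU]] := @ultraFilterLemma nat \oo _.
have FU : ProperFilter U := @ultra_proper _ _ UU.
have : forall y, exists l, forall e, 0 < e -> U [set n | rnorm (l - T (S n y)) < e].
  move=> y; pose r := `|c| * rnorm y + 1.
  have r0 : 0 < r by rewrite ltr_wpDl// mulr_ge0 ?rnorm_ge0.
  pose u n := T (r^-1%:C%C *: S n y).
  have [|l [_ ul]] := cT (u @ U) _.
    apply: (@filterS _ U _ setT); last exact: filterT.
    move=> n _; apply: subset_closure; exists (r^-1%:C%C *: S n y) => //=.
    rewrite normE lecR rnormZr gtr0_norm ?invr_gt0// ler_pdivrMl// mulr1.
    rewrite (le_trans (cS n y))// (le_trans (ler_wpM2r _ (ler_norm c))) ?rnorm_ge0//.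
    by rewrite lerDl.
  exists (r%:C%C *: l) => e e0.
  have er0 : 0 < e / r by rewrite divr_gt0.
  have : U (u @^-1` [set z | rnorm (l - z) < e / r]).
    have [//|UC] := in_ultra_setVsetC (u @^-1` [set z | rnorm (l - z) < e / r]) UU.
    by have [z []] := ul (~` [set z | rnorm (l - z) < e / r]) _ UC (nbhs_rnorm l er0).
  apply: filterS => n /=; rewrite /u.
  rewrite (linZ (bounded_operator_lin bT)) ltr_pdivlMr// => lt_e.
  have -> : r%:C%C *: l - T (S n y) = r%:C%C *: (l - r^-1%:C%C *: T (S n y)).
    by rewrite scalerBr scalerA -rmorphM /= mulfV ?gt_eqF// scale1r.
  by rewrite rnormZr gtr0_norm// mulrC.
move=> /choice[L HL]; exists L => s e N e0.
have : U ([set n | (N <= n)%N] `&`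
    [set n | {in s, forall y, rnorm (L y - T (S n y)) < e}]).
  apply: filterI; first by apply: sU; exists N.
  elim: s => [|y s ih]; first by apply: (@filterS _ U _ setT); last exact: filterT.
  apply: filterS (filterI (HL y e e0) ih) => n [/= Hy Hs] z.
  by rewrite inE => /predU1P[->|/Hs].
by move=> /filter_ex[n [Nn Hn]]; exists n.
Qed.

End CompactOperators.

(** For compact [P] and [Q] the map [S |-> P S Q] sends bounded sequences to
    relatively compact ones in operator norm: the pointwise limit of [P S] along an
    ultrafilter is Lipschitz, hence uniform on the totally bounded image of the unit
    ball under [Q]. *)
Lemma compact_sandwich_limit (R : realType) (X : normedModType R[i])
    (P Q : X -> X) (S : nat -> X -> X) (c : R) :
  compact_operator P -> compact_operator Q -> 0 <= c ->
  (forall n, linear (S n)) -> (forall n, dominated c (S n)) ->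
  exists T, forall (e : R) N, 0 < e ->
    exists2 n, (N <= n)%N & dominated e (T \- (P \o S n \o Q)).
Proof.
move=> cP cQ c0 linS cS.
have [L HL] := compact_pointwise_limit cP cS; exists (L \o Q).
have [p p0 pP] := bounded_operatorP (proj1 cP).
have linQ := bounded_operator_lin (proj1 cQ).
have linP := bounded_operator_lin (proj1 cP).
have PSB n y y' : rnorm (P (S n y) - P (S n y')) <= p * c * rnorm (y - y').
  rewrite -(linB linP) -(linB (linS n)).
  by have := dominated_comp (ltW p0) pP (cS n); apply.
have LB y y' : rnorm (L y - L y') <= p * c * rnorm (y - y').
  apply/ler_addgt0Pr => e e0.
  have [|n _ Hn] := HL [:: y; y'] (e / 2) 0%N; first by rewrite divr_gt0.
  have Hy : rnorm (L y - P (S n y)) < e / 2 by rewrite Hn// inE eqxx.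
  have Hy' : rnorm (L y' - P (S n y')) < e / 2 by rewrite Hn// !inE eqxx orbT.
  have := ler_rnorm_via (P (S n y)) (L y) (L y').
  have := ler_rnorm_via (P (S n y')) (P (S n y)) (L y').
  rewrite (rnormBC (P (S n y')) (L y')); have := PSB n y y'; lra.
have Lhom t y : 0 <= t -> L (t%:C%C *: y) = t%:C%C *: L y.
  move=> t0; apply/eqP; rewrite -subr_eq0 -rnorm_eq0 eq_le rnorm_ge0 andbT.
  apply/ler_addgt0Pr => e e0; rewrite add0r.
  have t1 : 0 < t + 1 by rewrite ltr_wpDl.
  pose d := e / 2 / (t + 1); have d0 : 0 < d by rewrite !divr_gt0.
  have [n _ Hn] := HL [:: t%:C%C *: y; y] d 0%N d0.
  have H1 : rnorm (L (t%:C%C *: y) - P (S n (t%:C%C *: y))) < d.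
    by rewrite Hn// inE eqxx.
  have H2 : rnorm (L y - P (S n y)) < d by rewrite Hn// !inE eqxx orbT.
  rewrite (le_trans (ler_rnorm_via (P (S n (t%:C%C *: y))) _ _))//.
  rewrite (linZ (linS n)) (linZ linP) -scalerBr rnormZr ger0_norm//.
  rewrite -(linZ linP) -(linZ (linS n)) (rnormBC (P (S n y))).
  have e2 : (t + 1) * d = e / 2 by rewrite /d mulrC divfK ?gt_eqF.
  have td : t * rnorm (L y - P (S n y)) <= t * d by rewrite ler_wpM2l// ltW.
  lra.
move=> e N e0; have pc1 : 0 < p * c + 1 by rewrite ltr_wpDl// mulr_ge0// ltW.
pose r := e / 4 / (p * c + 1).
have r0 : 0 < r by rewrite !divr_gt0.
have pcr : p * c * r <= e / 4.
  rewrite (@le_trans _ _ ((p * c + 1) * r))// ?ler_wpM2r ?(ltW r0) ?lerDl//.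
  by rewrite /r mulrC divfK ?gt_eqF.
have [I [Y QY]] := compact_covered cQ r0.
have [|n Nn Hn] := HL [seq Y i | i <- enum I] (e / 2) N; first by rewrite divr_gt0.
exists n => // x.
have unit_case u : rnorm u <= 1 -> rnorm (L (Q u) - P (S n (Q u))) <= e.
  move=> /QY[i ui].
  have HYi : rnorm (L (Y i) - P (S n (Y i))) < e / 2.
    by apply: Hn; rewrite map_f// mem_enum.
  have pcu : p * c * rnorm (Q u - Y i) <= e / 4.
    by rewrite (le_trans _ pcr)// ler_wpM2l// mulr_ge0// ltW.
  have := ler_rnorm_via (L (Y i)) (L (Q u)) (P (S n (Q u))).
  have := ler_rnorm_via (P (S n (Y i))) (L (Y i)) (P (S n (Q u))).
  have := LB (Q u) (Y i); have := PSB n (Y i) (Q u).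
  rewrite (rnormBC (Y i)); lra.
have nx0 := rnorm_ge0 x; have [x0|x0] := eqVneq (rnorm x) 0.
  move/eqP: (x0); rewrite rnorm_eq0 => /eqP ->.
  rewrite rnorm0 mulr0 /= (lin0 linQ) (lin0 (linS n)) (lin0 linP) subr0.
  have := Lhom 0 0 (lexx 0); rewrite scaler0 => ->.
  by rewrite rmorph0 scale0r rnorm0.
have nx : 0 < rnorm x by rewrite lt_def x0.
pose u := (rnorm x)^-1%:C%C *: x.
have xu : x = (rnorm x)%:C%C *: u.
  by rewrite scalerA -rmorphM /= mulfV ?gt_eqF// scale1r.
rewrite [X in rnorm X](_ : _ = (rnorm x)%:C%C *: (L (Q u) - P (S n (Q u)))).
  rewrite rnormZr gtr0_norm// mulrC ler_wpM2r// unit_case//.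
  by rewrite /u rnormZr gtr0_norm ?invr_gt0// mulVf ?gt_eqF.
by rewrite /= {1 2}xu (linZ linQ) Lhom// (linZ (linS n)) (linZ linP) scalerBr.
Qed.

Section FiniteDimensionalBound.
Variables (R : realType) (X : normedModType R[i]) (q : nat) (y : 'I_q -> X).

Let comb (v : 'I_q -> R) : X := \sum_(i < q) (v i)%:C%C *: y i.

Let comb_continuous : continuous (fun v : 'rV[R]_q => rnorm (comb (v ord0))).
Proof.
move=> v U /nbhs_ballP[e /= e0 eU].
have M0 : 0 < \sum_(i < q) rnorm (y i) + 1.
  by rewrite ltr_wpDl// sumr_ge0// => i _; exact: rnorm_ge0.
apply/nbhs_ballP; exists (e / (\sum_(i < q) rnorm (y i) + 1)) => /=.
  exact: divr_gt0.
move=> w vw; apply: eU; rewrite -ball_normE /=.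
apply: (@le_lt_trans _ _ (\sum_(i < q) `|v ord0 i - w ord0 i| * rnorm (y i))).
  have sub : comb (v ord0) - comb (w ord0) =
      \sum_(i < q) (v ord0 i - w ord0 i)%:C%C *: y i.
    rewrite /comb -sumrB; apply: eq_bigr => i _.
    by rewrite rmorphB scalerBl.
  apply: (@le_trans _ _ (rnorm (comb (v ord0) - comb (w ord0)))).
    rewrite ler_norml lerBlDr ler_rnorm_sub andbT lerNl opprB lerBlDr.
    by rewrite rnormBC ler_rnorm_sub.
  rewrite sub (le_trans (ler_rnorm_sum _ _ _))// ler_sum// => i _.
  by rewrite rnormZr.
have vwi i : `|v ord0 i - w ord0 i| <= e / (\sum_(i < q) rnorm (y i) + 1).
  by case: vw => _ /(_ ord0 i); rewrite -ball_normE => /ltW.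
apply: (@le_lt_trans _ _ (\sum_(i < q)
    e / (\sum_(i < q) rnorm (y i) + 1) * rnorm (y i))).
  by apply: ler_sum => i _; rewrite ler_wpM2r ?rnorm_ge0.
by rewrite -mulr_sumr mulrAC ltr_pdivrMr// ltr_pM2l// ltrDl.
Qed.

(** On the face [v i = 1] of the unit cube the norm of the combination attains its
    minimum; scaling by the largest coordinate reduces the general case to these
    finitely many compact faces. *)
Lemma independent_lower_bound :
  (forall c : 'I_q -> R[i], (exists i, c i != 0) -> \sum_(i < q) c i *: y i <> 0) ->
  exists2 k : R, 0 < k &
    forall (a : 'I_q -> R) i, k * `|a i| <= rnorm (\sum_(j < q) (a j)%:C%C *: y j).
Proof.
move=> indep.
pose face i : set 'rV[R]_q :=
  [set v | forall j, (if j == i then [set 1] else `[-1, 1]%classic) (v ord0 j)].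
have faceP i : exists k, 0 < k /\ forall v, face i v -> k <= rnorm (comb (v ord0)).
  have cface : compact (face i).
    apply: (@rV_compact R q (fun j => if j == i then [set 1] else `[-1, 1]%classic)).
    by move=> j; case: (j == i); [exact: compact_set1|exact: segment_compact].
  have face0 : face i !=set0.
    exists (const_mx 1 : 'rV[R]_q) => j; rewrite mxE; case: ifP => // _ /=.
    by rewrite in_itv /= lexx andbT; lra.
  have [|v /set_mem vi vmin] := compact_EVT_min face0 cface
    (f := fun v : 'rV[R]_q => rnorm (comb (v ord0))).
    exact: continuous_subspaceT comb_continuous.
  exists (rnorm (comb (v ord0))); split; last by move=> w wi; apply/vmin/mem_set.
  rewrite rnorm_gt0; apply/eqP; apply: indep; exists i.
  have := vi i; rewrite eqxx /= => ->.
  exact: oner_neq0.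
have [k Hk] := choice faceP.
pose m := \big[Num.min/1]_i k i.
have m0 : 0 < m by apply: lt_bigmin => // i _; have [] := Hk i.
exists m => // a i0.
case: (@arg_maxP _ _ _ i0 predT (fun i => `|a i|) isT) => i _ imax.
have [ai0|ai0] := eqVneq (a i) 0.
  have := imax i0 isT; rewrite ai0 normr0 => /= ai; rewrite (_ : `|a i0| = 0).
    by rewrite mulr0 rnorm_ge0.
  by apply/eqP; rewrite eq_le ai normr_ge0.
pose v : 'rV[R]_q := \row_j (a j / a i).
have vi : face i v.
  move=> j; rewrite mxE; case: eqVneq => [->|_]; first by rewrite /= divff.
  rewrite /= in_itv /= -ler_norml normrM normfV ler_pdivrMr ?normr_gt0// mul1r.
  exact: imax.
have -> : \sum_(j < q) (a j)%:C%C *: y j = (a i)%:C%C *: comb (v ord0).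
  rewrite /comb scaler_sumr; apply: eq_bigr => j _.
  by rewrite scalerA mxE -rmorphM /= mulrC divfK.
rewrite rnormZr mulrC ler_pM ?normr_ge0 ?(ltW m0)//; first exact: imax.
have [_ /(_ v vi)] := Hk i; apply: le_trans; rewrite /m.
exact: bigmin_le_cond.
Qed.

End FiniteDimensionalBound.

(** * Growth of products of compact operators *)

Section Words.
Variables (R : realType) (X : completeNormedModType R[i]) (A : set (X -> X)).
Hypothesis algA : operator_algebra A.
Hypothesis closedA : norm_closed A.
Variables (I : finType) (b : I -> X -> X).
Hypothesis Ab : forall i, A (b i).

Definition word_op (w : seq I) : X -> X := foldr (fun i S => b i \o S) idfun w.

Lemma word_op_cat v w : word_op (v ++ w) = word_op v \o word_op w.
Proof.
elim: v => [|i v ih] /=; first by apply/funext.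
by rewrite ih; apply/funext.
Qed.

Lemma word_op_rcons w i : word_op (rcons w i) = word_op w \o b i.
Proof. by rewrite -cats1 word_op_cat. Qed.

Lemma alg_word_op i w : A (word_op (i :: w)).
Proof.
elim: w i => [|j w ih] i /=; first exact: Ab.
exact: (alg_comp algA (Ab i) (ih j)).
Qed.

Lemma bounded_word_op w : bounded_operator (word_op w).
Proof.
case: w => [|i w]; first exact: bounded_operator_id.
exact: (alg_bounded algA (alg_word_op i w)).
Qed.

Lemma opnorm_word_bounded n :
  exists2 C : R, 0 < C & forall w, size w = n -> opnorm (word_op w) <= C.
Proof.
have /choice[c Hc] : forall w : n.-tuple I,
    exists c : R, 0 <= c /\ opnorm (word_op w) <= c.
  move=> w; exists (opnorm (word_op w)); split=> //.
  exact: opnorm_ge0 (bounded_word_op w).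
exists (\sum_w c w + 1) => [|w wn].
  by rewrite ltr_wpDl// sumr_ge0// => w _; have [] := Hc w.
have /eqP wn' := wn; have [_] := Hc (Tuple wn'); move=> /le_trans; apply.
rewrite (bigD1 (Tuple wn'))//= -addrA lerDl addr_ge0// sumr_ge0// => w' _.
by have [] := Hc w'.
Qed.

Hypothesis compact_b : forall i, compact_operator (b i).

Lemma word_covered (k : nat) (r : R) : 0 < r ->
  (forall i, exists2 J : finType, (#|J| <= k)%N & covered J r (b i)) ->
  forall w, exists2 J : finType, (#|J| <= k ^ size w)%N &
    covered J (r ^+ size w) (word_op w).
Proof.
move=> r0 cov; elim=> [|i w [J kJ JT]] /=.
  by exists unit; [rewrite card_unit|rewrite expr0; exact: covered_idfun].
have [J' kJ' JT'] := cov i; exists (J' * J)%type.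
  by rewrite card_prod expnS leq_mul.
rewrite exprS; apply: covered_comp => //; last exact: exprn_gt0.
exact: (bounded_operator_lin (proj1 (compact_b i))).
Qed.

Section Growth.
Variable c : R.
Hypothesis c0 : 0 < c.
Hypothesis growth : forall n, exists2 w, size w = n & c <= opnorm (word_op w).

(** Strip the outer letters of a long word of norm at least [c] as long as this more
    than doubles the norm.  Since words of length [N] are uniformly bounded, the
    process stops before the length falls to [N]. *)
Lemma balanced_words N : exists i a j, [/\ (N <= size a)%N,
  c <= opnorm (word_op (i :: rcons a j)) &
  opnorm (word_op a) <= 2 * opnorm (word_op (i :: rcons a j))].
Proof.
apply: contrapT => nobal.
have strip k w : size w = (N + k.*2)%N -> c <= opnorm (word_op w) ->
    exists2 a, size a = N & 2 ^+ k * opnorm (word_op w) <= opnorm (word_op a).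
  elim: k w => [|k ih] w; first by rewrite addn0; exists w; rewrite // expr0 mul1r.
  rewrite doubleS !addnS; case: w => [//|i w]; case/lastP: w => [//|a j] /=.
  rewrite size_rcons => -[sa] cw.
  have [le2|gt2] := leP (opnorm (word_op a)) (2 * opnorm (word_op (i :: rcons a j))).
    by exfalso; apply: nobal; exists i, a, j; split; rewrite // sa leq_addr.
  have [|a' sa' le'] := ih a sa.
    rewrite (le_trans cw)// (le_trans _ (ltW gt2))// ler_peMl ?ler1n//.
    exact: le_trans (ltW c0) cw.
  exists a' => //; apply: le_trans le'.
  by rewrite exprSr -mulrA ler_wpM2l ?exprn_ge0// ltW.
have [C C0 HC] := opnorm_word_bounded N.
have [k kC] := expr2_unbounded (C / c).
have [w sw cw] := growth (N + k.*2).
have [a sa le_a] := strip k w sw cw.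
move: kC; rewrite ltr_pdivrMr//; apply/negP; rewrite -leNgt.
rewrite (le_trans _ (HC a sa))// (le_trans _ le_a)// ler_wpM2l// exprn_ge0//.
Qed.

(** With the outer letters fixed, the normalized words are [P S Q] for fixed compact
    [P] and [Q] and bounded [S], the form required by [compact_sandwich_limit]. *)
Lemma balanced_words_ends : exists i j, forall N, exists a, [/\ (N <= size a)%N,
  c <= opnorm (word_op (i :: rcons a j)) &
  opnorm (word_op a) <= 2 * opnorm (word_op (i :: rcons a j))].
Proof.
apply: contrapT => noends.
have /choice[N HN] : forall p : I * I, exists N, forall a, (N <= size a)%N ->
    c <= opnorm (word_op (p.1 :: rcons a p.2)) ->
    ~ opnorm (word_op a) <= 2 * opnorm (word_op (p.1 :: rcons a p.2)).
  move=> [i j]; apply: contrapT => noN; apply: noends; exists i, j => N.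
  apply: contrapT => noa; apply: noN; exists N => a Na ca le2.
  by apply: noa; exists a.
have [i [a [j [Na ca le2]]]] := balanced_words (\sum_p N p).
apply: (HN (i, j) a) => //; rewrite (leq_trans _ Na)//.
by rewrite (bigD1 (i, j))//= leq_addr.
Qed.

(** Let [T] be a limit of normalized balanced words.  If [T] took [q] independent
    values, then so would the nearby normalized words [w], and at every scale: a word
    of length [n] would map [2 ^ (n q)] grid points of the unit ball to points at
    mutual distance at least a constant times [2 ^- n].  But its image of the unit
    ball is covered by [k ^ n] balls of radius [4 ^- n], where [k] only depends on the
    letters, so [2 ^ q <= k]. *)
Lemma growth_finite_rank : exists T q, [/\ A T, T <> cst 0 &
  forall x : 'I_q -> X, exists2 a : 'I_q -> R[i],
    exists i, a i != 0 & \sum_(i < q) a i *: T (x i) = 0].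
Proof.
have [i [j /choice[a Ha]]] := balanced_words_ends.
pose w n := i :: rcons (a n) j; pose nw n := opnorm (word_op (w n)).
have cw n : c <= nw n by have [] := Ha n.
have nw0 n : 0 < nw n := lt_le_trans c0 (cw n).
pose S n := (nw n)^-1%:C%C \*: word_op (a n).
pose W n := (nw n)^-1%:C%C \*: word_op (w n).
have lin_word v : linear (word_op v) := bounded_operator_lin (bounded_word_op v).
have linS n : linear (S n).
  exact: bounded_operator_lin (bounded_operatorZ _ (bounded_word_op _)).
have S2 n : dominated 2 (S n).
  move=> x /=; rewrite rnormZr gtr0_norm ?invr_gt0// ler_pdivrMl//.
  rewrite (le_trans (dominated_opnorm (bounded_word_op (a n)) x))//.
  by rewrite mulrA ler_wpM2r ?rnorm_ge0// mulrC; have [] := Ha n.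
have WE n : W n = b i \o S n \o b j.
  apply/funext => x; rewrite /W /w -rcons_cons word_op_rcons /=.
  by rewrite (linZ (alg_lin algA (Ab i))).
have [T HT] := compact_sandwich_limit (compact_b i) (compact_b j) (ler0n R 2) linS S2.
have AW n : A (W n) by apply: (algZ algA); exact: alg_word_op.
have AT : A T.
  apply: (alg_uniform_limit algA closedA) => e e0.
  by have [n _ Tn] := HT e 0%N e0; exists (W n); rewrite // WE.
have T0 : T <> cst 0.
  move=> T0; have [n _] := HT 2^-1 0%N (ltac:(by rewrite invr_gt0)).
  rewrite -WE => HW; have : nw n <= 2^-1 * nw n.
    apply: opnorm_le => [|x]; first by rewrite mulr_ge0// ltW.
    have := HW x; rewrite T0 /= sub0r rnormN rnormZr gtr0_norm ?invr_gt0//.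
    by rewrite ler_pdivrMl// mulrCA mulrA.
  by have := nw0 n; lra.
have /choice[J HJ] : forall i, exists J : finType, covered J 4^-1 (b i).
  by move=> i'; apply: compact_covered; rewrite ?invr_gt0.
pose k := (\sum_i #|J i|)%N.
have cov v := @word_covered k 4^-1 (ltac:(by rewrite invr_gt0)) _ v.
(* The rank bound [q = k] suffices since [k < 2 ^ k]. *)
exists T, k; split=> // x; apply: contrapT => indep.
have [|m m0 Hm] := @independent_lower_bound _ _ k (T \o x).
  by move=> d d0 sd; apply: indep; exists d.
pose M := 1 + \sum_(l < k) rnorm (x l).
have M0 : 0 < M by rewrite ltr_pwDl// sumr_ge0// => l _; exact: rnorm_ge0.
have [N HN] := expr2_unbounded (4 * M / (c * m)).
have [|n Nn] := HT (m / (2 * M)) N.+1; first by rewrite divr_gt0// mulr_gt0.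
rewrite -WE => TW.
(* The constant [m] of [independent_lower_bound] is halved in passing from [T] to the
   nearby [W n]; the bound holds for coefficients of any size, hence at all scales. *)
have sep (d : 'I_k -> R) l : 1 <= `|d l| ->
    m / 2 <= rnorm (\sum_(l < k) (d l)%:C%C *: W n (x l)).
  case: (@arg_maxP _ _ _ l predT (fun l => `|d l|) isT) => l' _ lmax dl.
  have {dl} dl' : 1 <= `|d l'| by apply: le_trans dl _; exact: lmax.
  have := Hm d l'; set u := \sum_(_ < _) _; set v := \sum_(_ < _) _ => mu.
  have uv : rnorm (u - v) <= `|d l'| * (m / 2).
    rewrite /u /v -sumrB (le_trans (ler_rnorm_sum _ _ _))//.
    apply: (@le_trans _ _ (\sum_(l < k) `|d l'| * (m / (2 * M)) * rnorm (x l))).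
      apply: ler_sum => l0 _; rewrite -scalerBr rnormZr -mulrA ler_pM ?rnorm_ge0//.
        exact: lmax.
      exact: TW.
    rewrite -mulr_sumr -mulrA ler_wpM2l//.
    have -> : m / 2 = m / (2 * M) * M by field; rewrite gt_eqF.
    by rewrite ler_wpM2l ?lerDr// divr_ge0 ?mulr_ge0// ltW.
  have := ler_rnorm_sub u v; nra.
pose s := size (w n); pose L := (2 ^ s)%N.
have s0 : (N < s)%N by rewrite /s /w /= size_rcons; have [] := Ha n; lia.
have Jk l : (#|J l| <= k)%N by rewrite /k (bigD1 l)//= leq_addr.
have [J' kJ' [Y covY]] := cov (fun l => ex_intro2 _ _ (J l) (Jk l) (HJ l)) (w n).
have L0 : 0 < L%:R :> R by rewrite ltr0n expn_gt0.
have LM0 : 0 < L%:R * M by rewrite mulr_gt0.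
pose grid (f : {ffun 'I_k -> 'I_L}) : X :=
  \sum_(l < k) ((f l)%:R / (L%:R * M))%:C%C *: x l.
have grid1 f : rnorm (grid f) <= 1.
  apply: (le_trans (ler_rnorm_sum _ _ _)).
  apply: (@le_trans _ _ (\sum_(l < k) M^-1 * rnorm (x l))).
    apply: ler_sum => l _; rewrite rnormZr ler_wpM2r ?rnorm_ge0//.
    rewrite ger0_norm ?divr_ge0 ?(ltW LM0)// ler_pdivrMr//.
    by rewrite mulrCA mulVf ?gt_eqF// mulr1 ler_nat ltnW.
  by rewrite -mulr_sumr mulrC ler_pdivrMr// mul1r lerDr.
have /choice[code Hcode] : forall f, exists l,
    rnorm (word_op (w n) (grid f) - Y l) <= 4^-1 ^+ s by move=> f; exact: covY.
have inj_code : injective code.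
  move=> f g fg; apply/ffunP => l0; apply: contrapT => fgl.
  pose d l : R := (f l)%:R - (g l)%:R.
  have d1 : 1 <= `|d l0|.
    have : (f l0 : nat) <> g l0 by move=> /val_inj.
    rewrite /d; case: (ltngtP (f l0) (g l0)) => // fgl' _.
      rewrite distrC -natrB ?ger0_norm// ?ler1n ?subn_gt0//; exact: ltnW.
    by rewrite -natrB ?ger0_norm// ?ler1n ?subn_gt0//; exact: ltnW.
  have := sep d l0 d1.
  have -> : \sum_(l < k) (d l)%:C%C *: W n (x l) =
      ((nw n)^-1 * (L%:R * M))%:C%C *:
      (word_op (w n) (grid f) - word_op (w n) (grid g)).
    rewrite -(linB (lin_word _)) /grid -sumrB (lin_sum (lin_word _)) scaler_sumr.
    apply: eq_bigr => l _; rewrite -scalerBl -rmorphB.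
    rewrite (linZ (lin_word (w n)) _ (x l)) [W n _]/GRing.scale_fun /=.
    rewrite !scalerA -!rmorphM /=; congr (_%:C%C *: _); rewrite /d.
    by field; rewrite !gt_eqF.
  rewrite rnormZr gtr0_norm ?mulr_gt0 ?invr_gt0//.
  have : rnorm (word_op (w n) (grid f) - word_op (w n) (grid g)) <= 2 * 4^-1 ^+ s.
    rewrite (le_trans (ler_rnorm_via (Y (code f)) _ _))// mulrDl !mul1r lerD//.
    by rewrite fg rnormBC.
  set u := rnorm _ => u4 mu.
  have : m / 2 <= c^-1 * (L%:R * M) * (2 * 4^-1 ^+ s).
    have nwc : (nw n)^-1 * (L%:R * M) <= c^-1 * (L%:R * M).
      by rewrite ler_wpM2r ?(ltW LM0)// lef_pV2 ?posrE.
    apply: (le_trans mu); apply: ler_pM => //; last exact: rnorm_ge0.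
    by rewrite ltW// mulr_gt0// invr_gt0.
  apply/negP; rewrite -ltNge.
  have t0 : 0 < 2 ^+ s :> R by rewrite exprn_gt0.
  have -> : c^-1 * (L%:R * M) * (2 * 4^-1 ^+ s) = 2 * M / (c * 2 ^+ s).
    have -> : 4^-1 ^+ s = (2 ^+ s * 2 ^+ s)^-1 :> R.
      by rewrite -exprMn -natrM exprVn.
    by rewrite /L natrX; field; rewrite !gt_eqF.
  have : 4 * M / (c * m) < 2 ^+ s by rewrite (lt_trans HN)// ltr_eXn2l// ltr1n.
  rewrite ltr_pdivrMr ?mulr_gt0// => lt1.
  by rewrite ltr_pdivrMr ?mulr_gt0//; lra.
have := leq_trans (leq_card code inj_code) kJ'.
rewrite card_ffun !card_ord -expnM mulnC expnM => le_pow.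
have := ltn_expl k (isT : (1 < 2)%N); rewrite ltnNge => /negP; apply.
by rewrite -(leq_exp2r _ _ (leq_ltn_trans (leq0n N) s0)).
Qed.

End Growth.
End Words.

(** * Transitive actions *)

Section Transitivity.
Variables (R : realType) (X : normedModType R[i]) (A : set (X -> X)).
Hypothesis algA : operator_algebra A.
Implicit Types (B T : X -> X) (x y z : X).

(** The algebra generated by [A], its commutant and the identity; as the two sets
    commute with each other, sums of products [s a] are enough. *)
Definition bicommuting_sum : set (X -> X) := [set B |
  exists (I : finType) (s a : I -> X -> X),
    [/\ forall i, commutant A (s i), forall i, A (a i) \/ a i = idfun &
        B = fun x => \sum_i s i (a i x)]].

Lemma bicommuting_sum_bounded B : bicommuting_sum B -> bounded_operator B.
Proof.
move=> [I [s [a [cs Aa ->]]]].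
have ba i : bounded_operator (a i).
  by case: (Aa i) => [/(alg_bounded algA)//|->]; exact: bounded_operator_id.
elim: (index_enum I) => [|i l ih].
  rewrite (_ : (fun _ => _) = cst 0); first exact: (alg_bounded algA (alg0 algA)).
  by apply/funext => x; rewrite big_nil.
rewrite (_ : (fun _ => _) = (s i \o a i) \+ (fun x => \sum_(i <- l) s i (a i x))).
  exact: bounded_operatorD (bounded_operator_comp (commutant_bounded (cs i)) (ba i)) ih.
by apply/funext => x; rewrite big_cons.
Qed.

Lemma bicommuting_sum_id : bicommuting_sum idfun.
Proof.
exists unit, (fun=> idfun), (fun=> idfun); split=> [_|_|]; first exact: commutant_id.
  by right.
by apply/funext => x; rewrite big_const card_unit /= addr0.
Qed.

Lemma bicommuting_sum_lin (c : R[i]) B B' :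
  bicommuting_sum B -> bicommuting_sum B' -> bicommuting_sum ((c \*: B) \+ B').
Proof.
move=> [I [s [a [cs Aa ->]]]] [J [t [b [ct Ab ->]]]].
exists (I + J)%type, (fun p => match p with inl i => c \*: s i | inr j => t j end),
  (fun p => match p with inl i => a i | inr j => b j end); split.
- by case=> [i|j]; [exact: commutantZ|exact: ct].
- by case.
- by apply/funext => x; rewrite big_sumType /= scaler_sumr.
Qed.

Lemma bicommuting_sum_comp T B : (A `|` commutant A) T ->
  bicommuting_sum B -> bicommuting_sum (T \o B).
Proof.
move=> AT [I [s [a [cs Aa ->]]]]; case: AT => [AT|cT].
  exists I, s, (fun i => T \o a i); split=> // [i|].
    by left; case: (Aa i) => [Aai|->]; [exact: (alg_comp algA)|].
  apply/funext => x /=; rewrite (lin_sum (alg_lin algA AT)); apply: eq_bigr => i _.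
  by rewrite (commutantE _ (cs i) AT).
exists I, (fun i => T \o s i), a; split=> // [i|]; first exact: commutant_comp.
by apply/funext => x /=; rewrite (lin_sum (bounded_operator_lin (proj1 cT))).
Qed.

Definition orbit_closure y : set X :=
  [set z | forall e : R, 0 < e -> exists2 B, bicommuting_sum B & rnorm (B y - z) < e].

Lemma orbit_closure_subspace y : closed_subspace (orbit_closure y).
Proof.
split.
- apply: closed_rnorm => z Hz e e0.
  have [|z' Oz' zz'] := Hz (e / 2); first by rewrite divr_gt0.
  have [|B OB Bz'] := Oz' (e / 2); first by rewrite divr_gt0.
  exists B => //; rewrite (le_lt_trans (ler_rnorm_via z' _ _))//.
  by rewrite (splitr e) ltrD// rnormBC.
- move=> e e0; exists (cst 0); last by rewrite subr0 rnorm0.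
  exists void, (fun=> idfun), (fun=> idfun); split; [by case|by case|].
  by apply/funext => x; rewrite big_pred0// => -[].
- move=> c z z' Oz Oz' e e0.
  have c1 : 0 < rnorm c + 1 by rewrite ltr_wpDl ?rnorm_ge0.
  have [|B OB Bz] := Oz (e / 2 / (rnorm c + 1)); first by rewrite !divr_gt0.
  have [|B' OB' Bz'] := Oz' (e / 2); first by rewrite divr_gt0.
  exists ((c \*: B) \+ B'); first exact: bicommuting_sum_lin.
  rewrite /= opprD addrACA -scalerBr (le_lt_trans (ler_rnormD _ _))//.
  rewrite (splitr e) ler_ltD// rnormZ.
  apply: (@le_trans _ _ ((rnorm c + 1) * rnorm (B y - z))).
    by rewrite ler_wpM2r ?rnorm_ge0// lerDl.
  by rewrite mulrC -ler_pdivlMr// ltW.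
Qed.

Lemma orbit_closure_hyperinvariant y : hyperinvariant A (orbit_closure y).
Proof.
move=> T AT _ [z Oz <-] e e0.
have bT : bounded_operator T.
  by case: AT => [/(alg_bounded algA)//|/commutant_bounded].
have [c c0 cT] := bounded_operatorP bT.
have [|B OB Bz] := Oz (e / c); first by rewrite divr_gt0.
exists (T \o B); first exact: bicommuting_sum_comp.
rewrite /= -(linB (bounded_operator_lin bT)) (le_lt_trans (cT _))//.
by rewrite mulrC -ltr_pdivlMr.
Qed.

Lemma orbit_dense y z (e : R) :
  ~ (exists M : set X, nontrivial_subspace M /\ hyperinvariant A M) ->
  y <> 0 -> 0 < e -> exists2 B, bicommuting_sum B & rnorm (B y - z) < e.
Proof.
move=> noM y0 e0; suff : orbit_closure y z by apply.
apply: contrapT => nz; apply: noM; exists (orbit_closure y); split.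
  split; first exact: orbit_closure_subspace.
    move=> O0; apply: y0; have : orbit_closure y y.
      by move=> d d0; exists idfun; [exact: bicommuting_sum_id|rewrite subrr rnorm0].
    by rewrite O0.
  by move=> OT; apply: nz; rewrite OT.
exact: orbit_closure_hyperinvariant.
Qed.

End Transitivity.

Section LomonosovHilden.
Variables (R : realType) (X : completeNormedModType R[i]) (A : set (X -> X)).
Hypothesis algA : operator_algebra A.

Lemma commutant_word_op (I : finType) (b : I -> X -> X) s w x :
  (forall i, A (b i)) -> commutant A s -> s (word_op b w x) = word_op b w (s x).
Proof.
by move=> Ab cs; elim: w => //= i w ih; rewrite (commutantE _ cs (Ab i)) ih.
Qed.

(** Hilden's form of Lomonosov's argument.  Let [U] be a small ball around [x0] with
    [K x0 <> 0].  By compactness finitely many sums [B = sum s a], with [s] in the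
    commutant and [a] in [A] or the identity, are enough to map each [K x] with [x] in
    [U] back into [U]; hence for all [n] some product [B K ... B K x0] with [n] factors
    stays in [U].  The commuting [s] can be moved to the left, so some product of [n]
    letters [a K] cannot be too small. *)
Lemma transitive_growth K : A K -> compact_operator K -> K <> cst 0 ->
  ~ (exists M : set X, nontrivial_subspace M /\ hyperinvariant A M) ->
  exists (I : finType) (b : I -> X -> X) (c : R),
    [/\ forall i, A (b i), forall i, compact_operator (b i), 0 < c &
        forall n, exists2 w, size w = n & c <= opnorm (word_op b w)].
Proof.
move=> AK cK K0 noM.
have linK := alg_lin algA AK.
have [x0 [Kx0 x0half]] : exists x0, K x0 <> 0 /\ rnorm x0 <= 2^-1.
  have [v Kv] : exists v, K v <> 0.
    apply: contrapT => /forallNP Kv; apply: K0; apply/funext => x.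
    exact: contrapT (Kv x).
  have v0 : 0 < rnorm v.
    by rewrite rnorm_gt0; apply/eqP => v0; apply: Kv; rewrite v0 (lin0 linK).
  exists ((2 * rnorm v)^-1%:C%C *: v); rewrite (linZ linK); split.
    move=> /eqP; rewrite scaler_eq0 => /orP[|/eqP//].
    by rewrite (inj_eq (@complexI R) _ 0) gt_eqF// invr_gt0 mulr_gt0.
  rewrite rnormZr gtr0_norm ?invr_gt0 ?mulr_gt0// invfM -mulrA mulVf ?gt_eqF//.
  by rewrite mulr1.
have nK0 : 0 < rnorm (K x0) by rewrite rnorm_gt0; exact/eqP.
have [k k0 kK] := bounded_operatorP (alg_bounded algA AK).
have nx0 : 0 < rnorm x0 by rewrite -(pmulr_rgt0 _ k0) (lt_le_trans nK0)// kK.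
pose d := rnorm (K x0) / 2; have d0 : 0 < d by rewrite divr_gt0.
pose r := Num.min 2^-1 (d / k).
have r0 : 0 < r by rewrite lt_min invr_gt0 divr_gt0// andbT.
have rd : k * r <= d by rewrite mulrC -ler_pdivlMr// ge_min lexx orbT.
have rx0 : r <= rnorm x0 / 2.
  rewrite (@le_trans _ _ (d / k)) ?ge_min ?lexx ?orbT// ler_pdivrMr// /d.
  by rewrite mulrAC ler_pM2r ?invr_gt0// mulrC.
have [||J [B [OB HB]]] :=
  @compact_operator_selection _ _ K (bicommuting_sum A) x0 d r cK.
- by move=> B; exact: bicommuting_sum_bounded.
- move=> y dy; apply: orbit_dense => // y0.
  by move: dy; rewrite y0 rnorm0 leNgt d0.
have /choice[q Hq] : forall j,
    exists q : {I : finType & ((I -> X -> X) * (I -> X -> X))%type},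
    [/\ forall i, commutant A ((tagged q).1 i),
        forall i, A ((tagged q).2 i) \/ (tagged q).2 i = idfun &
        B j = fun x => \sum_i (tagged q).1 i ((tagged q).2 i x)].
  by move=> j; have [I [s [a HI]]] := OB j; exists (existT _ I (s, a)).
pose I : finType := {j : J & tag (q j)}.
pose s (p : I) := (tagged (q (tag p))).1 (tagged p).
pose a (p : I) := (tagged (q (tag p))).2 (tagged p).
have cs p : commutant A (s p) by have [+ _ _] := Hq (tag p); apply.
have aK p : A (a p \o K).
  by have [_ /(_ (tagged p)) + _] := Hq (tag p); rewrite -/(a p) => -[Aa|->] //;
    exact: (alg_comp algA).
have ba p : bounded_operator (a p).
  have [_ /(_ (tagged p)) + _] := Hq (tag p); rewrite -/(a p) => -[|->].
    exact: alg_bounded.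
  exact: bounded_operator_id.
have /choice[f Hf] : forall p, exists f : R, 0 < f /\ dominated f (s p).
  by move=> p; have [f f0 fs] := bounded_operatorP (proj1 (cs p)); exists f.
(* Scaling the letters by a bound [F] for the sums of the norms of the [s] makes the
   lower bound independent of the length of the words. *)
pose F := 1 + \sum_j \sum_(i : tag (q j)) f (existT _ j i).
have F_ge0 j : 0 <= \sum_(i : tag (q j)) f (existT _ j i).
  by apply: sumr_ge0 => i _; rewrite ltW//; have [] := Hf (existT _ j i).
have F0 : 0 < F by rewrite ltr_pwDl// sumr_ge0.
pose b p := F%:C%C \*: (a p \o K).
have Ab p : A (b p) by apply: (algZ algA).
have BK j x : B j (K x) = \sum_(i : tag (q j)) F^-1%:C%C *:
    s (existT _ j i) (b (existT _ j i) x).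
  have [_ _ ->] := Hq j; apply: eq_bigr => i _.
  rewrite /b /= (linZ (bounded_operator_lin (proj1 (cs _)))) scalerA -rmorphM /=.
  by rewrite mulVf ?gt_eqF// scale1r.
have sumF j : \sum_(i : tag (q j)) f (existT _ j i) <= F.
  by rewrite /F (bigD1 j)//= addrCA lerDl addr_ge0// sumr_ge0.
have lin_word v : linear (word_op b v).
  exact: bounded_operator_lin (bounded_word_op algA Ab v).
(* The prefix [v] lets the induction append the letters of [z] one at a time. *)
have stay n : exists2 z, rnorm (z - x0) < r & forall v mu, 0 <= mu ->
    (forall w, size w = n -> rnorm (word_op b v (word_op b w x0)) <= mu) ->
    rnorm (word_op b v z) <= mu.
  elim: n => [|n [z zr ih]].
    by exists x0 => [|v mu _ /(_ [::] erefl)]; rewrite ?subrr ?rnorm0.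
  have z1 : rnorm z <= 1.
    have := ler_rnorm_sub z x0; have : r <= 2^-1 by rewrite ge_min lexx.
    lra.
  have Kz : d <= rnorm (K z).
    have := ler_rnorm_sub (K x0) (K z); rewrite -(linB linK) => le1.
    have := kK (x0 - z); rewrite rnormBC => le2.
    have : k * rnorm (z - x0) <= d by rewrite (le_trans _ rd)// ler_wpM2l ?(ltW k0)// ltW.
    by rewrite -/d; move: le1 le2; rewrite /d; lra.
  have [j Bj] := HB z z1 Kz; exists (B j (K z)) => // v mu mu0 Hmu.
  rewrite BK (lin_sum (lin_word v)) (le_trans (ler_rnorm_sum _ _ _))//.
  apply: (@le_trans _ _ (\sum_(i : tag (q j)) F^-1 * (f (existT _ j i) * mu))).
    apply: ler_sum => i _; set p := existT _ j i.
    rewrite (linZ (lin_word v)) rnormZr gtr0_norm ?invr_gt0//.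
    rewrite ler_wpM2l ?invr_ge0 ?(ltW F0)// -(commutant_word_op _ _ Ab (cs p)).
    have [f0 fs] := Hf p; rewrite (le_trans (fs _))// ler_wpM2l ?(ltW f0)//.
    have -> : word_op b v (b p z) = word_op b (rcons v p) z.
      by rewrite word_op_rcons.
    apply: ih => // w wn; have := Hmu (p :: w); rewrite /= wn => /(_ erefl).
    by rewrite word_op_rcons.
  by rewrite -mulr_sumr -mulr_suml mulrA ler_piMl// mulrC ler_pdivrMr// mul1r.
exists I, b, (rnorm x0 / 4); split=> //.
- move=> p; rewrite /b.
  apply: (@compact_operator_comp _ _ (F%:C%C \*: a p)) => //.
  exact: bounded_operatorZ.
- by rewrite divr_gt0.
move=> n; apply: contrapT => small; have [z zr /(_ [::] (rnorm x0 / 4))] := stay n.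
have : rnorm x0 / 2 <= rnorm z.
  by have := ler_rnorm_sub x0 z; rewrite rnormBC; lra.
move=> z2 H; suff : rnorm z <= rnorm x0 / 4 by lra.
apply: H => [|w wn /=]; first by rewrite divr_ge0// ltW.
have bw := bounded_word_op algA Ab w.
have lt1 : opnorm (word_op b w) < rnorm x0 / 4.
  by rewrite ltNge; apply/negP => le1; apply: small; exists w.
rewrite (le_trans (dominated_opnorm bw x0))// -[leRHS]mulr1 ler_pM ?rnorm_ge0//.
- exact: opnorm_ge0.
- exact: ltW.
- by rewrite (le_trans x0half)// invf_le1// ler1n.
Qed.

End LomonosovHilden.

(** * Hyperinvariant subspaces *)

(** If [p(T)] is compact then so is [T p(T)], which moreover belongs to [A] although
    [p(T)] need not; hence [T p(T) = 0]. *)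
Lemma no_compact_nil (R : realType) (X : normedModType R[i]) (A : set (X -> X)) :
  operator_algebra A -> (forall T x, A T -> T x = x -> x = 0) ->
  (forall T, A T -> polynomially_compact T) ->
  (forall K, A K -> compact_operator K -> K = cst 0) ->
  forall T, A T -> exists n, forall x, iter n T x = 0.
Proof.
move=> algA fixA pcA noK T AT; have [p p0 cp] := pcA T AT.
exists (size p); apply: (horner_iter_eq0 algA fixA AT p0).
apply: noK; last exact: compact_operator_comp (alg_bounded algA AT) cp.
rewrite (_ : T \o _ = fun x => \sum_(i < size p) p`_i *: iter i.+1 T x).
  by apply: (alg_sum algA) => i; exact: (algZ algA _ (alg_iter algA i AT)).
apply/funext => x; rewrite /= /op_horner (lin_sum (alg_lin algA AT)).
by apply: eq_bigr => i _; rewrite (linZ (alg_lin algA AT)).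
Qed.

Lemma nil_algebra_hyperinvariant (R : realType) (X : completeNormedModType R[i])
    (A : set (X -> X)) :
  operator_algebra A -> norm_closed A -> A <> [set cst 0] ->
  (forall T, A T -> exists n, forall x, iter n T x = 0) ->
  exists M : set X, nontrivial_subspace M /\ hyperinvariant A M.
Proof.
move=> algA closedA A_neq0 nilA.
have [B AB B0] : exists2 B, A B & B <> cst 0.
  apply: contrapT => noB; apply: A_neq0; apply/seteqP; split=> [B AB|_ ->] /=.
    by apply: contrapT => B0; apply: noB; exists B.
  exact: alg0.
have [S [e [n [AS e0 nilS]]]] := nil_algebra_ball algA closedA nilA.
have [D [AD D0 Dz]] := @nil_ball_sandwich _ _ _ algA idfun S e n
  (bounded_operator_id _) (fun B AB => AB) (fun B AB => AB)
  (ex_intro2 _ _ B AB B0) AS e0 nilS.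
exact: (sandwich_hyperinvariant algA AD D0 Dz).
Qed.

Theorem theorem3p5 (R : realType) (X : completeNormedModType R[i])
    (A : set (X -> X))
    (X_infdim : infinite_dimensional X)
    (A_alg : operator_algebra A)
    (A_neq0 : A <> [set cst 0])
    (A_closed : norm_closed A)
    (A_qnil : forall T : X -> X, A T -> quasinilpotent T)
    (A_pcpt : forall T : X -> X, A T -> polynomially_compact T) :
  exists M : set X, nontrivial_subspace M /\ hyperinvariant A M.
Proof.
have fixA T x : A T -> T x = x -> x = 0.
  by move=> /A_qnil; exact: quasinilpotent_fixpoint.
have [[K [AK cK K0]]|noK] :=
    pselect (exists K, [/\ A K, compact_operator K & K <> cst 0]).
  apply: contrapT => noM.
  have [I [b [c [Ab cb c0 growth]]]] := transitive_growth A_alg AK cK K0 noM.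
  have [T [q [AT T0 depT]]] := growth_finite_rank A_alg A_closed Ab cb c0 growth.
  exact: noM (finite_rank_hyperinvariant A_alg fixA AT T0 depT).
apply: nil_algebra_hyperinvariant => //; apply: no_compact_nil => // K AK cK.
by apply: contrapT => K0; apply: noK; exists K.
Qed.
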